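(* Let $X$ be an affine variety over $K$. Then the map $\varprojlim \pi_\iota : X^{\mathrm{an}} \to \varprojlim \mathrm{Trop}(X,\iota)$ is a homeomorphism of $X^{\mathrm{an}}$ onto $\varprojlim \mathrm{Trop}(X,\iota)$, where the inverse limit (in the category of topological spaces) is taken over all affine embeddings $\iota$ of $X$ and all maps $\mathrm{Trop}(\varphi)$ described below.
   Context: $K$ is an algebraically closed field complete with respect to a nontrivial nonarchimedean valuation $\nu: K^*\to\mathbb{R}$, extended by $\nu(0)=\infty$. Let $\mathbf{R}=\mathbb{R}\cup\{\infty\}$ with the topology in which the rays $(a,\infty]$, $a\in\mathbb{R}$, form a basis of neighborhoods of $\infty$ (so $a\mapsto e^{-a}$ is a homeomorphism $\mathbf{R}\to\mathbb{R}_{\ge 0}$). A multiplicative seminorm on a $K$-algebra $A$ is a monoid map $|\cdot|:A\to\mathbb{R}_{\ge0}$ with $|0|=0$ and $|f+g|\le|f|+|g|$; it is compatible with $\nu$ if $|a|=\exp(-\nu(a))$ for $a\in K$. For an affine variety $X$, the analytification $X^{\mathrm{an}}$ is the set of multiplicative seminorms on $K[X]$ compatible with $\nu$, with the coarsest topology making $x\mapsto|f|_x$ continuous for every $f\in K[X]$. An affine embedding $\iota:X\hookrightarrow\mathbf{A}^m$ is a closed embedding $y\mapsto(f_1(y),\dots,f_m(y))$ for generators $f_1,\dots,f_m$ of the $K$-algebra $K[X]$. For $y\in\mathbf{A}^m(K)$ set $\mathrm{Trop}(y)=(\nu(y_1),\dots,\nu(y_m))\in\mathbf{R}^m$, and let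 $\mathrm{Trop}(X,\iota)\subset\mathbf{R}^m$ be the closure of $\{\mathrm{Trop}(\iota(x)) : x\in X(K)\}$. Define $\pi_\iota:X^{\mathrm{an}}\to\mathbf{R}^m$ by $\pi_\iota(x)=(-\log|f_1|_x,\dots,-\log|f_m|_x)$ with $-\log 0=\infty$. If $\jmath:X\hookrightarrow\mathbf{A}^n$ is another affine embedding and $\varphi:\mathbf{A}^m\to\mathbf{A}^n$ is a morphism equivariant with respect to some group homomorphism from the torus $T^m=(\mathbb{G}_m)^m$ to $T^n$, with $\jmath=\varphi\circ\iota$, then $\mathrm{Trop}(\varphi(y))$ depends only on $\mathrm{Trop}(y)$, giving a continuous map $\mathrm{Trop}(\varphi):\mathbf{R}^m\to\mathbf{R}^n$ which maps $\mathrm{Trop}(X,\iota)$ into $\mathrm{Trop}(X,\jmath)$ and satisfies $\pi_\jmath=\mathrm{Trop}(\varphi)\circ\pi_\iota$. The maps $\pi_\iota$ therefore induce $\varprojlim\pi_\iota$. *)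

(* Defs.v *)
From HB Require Import structures.
From mathcomp Require Import all_boot all_order all_algebra.
From Stdlib Require Import Reals.

Set Implicit Arguments.
Unset Strict Implicit.
Unset Printing Implicit Defensive.

Import GRing.Theory.
Local Open Scope ring_scope.

(* ---------- extended reals  R ∪ {∞}  (None = ∞) ---------- *)
Notation ER := (option R).

Definition er_add (x y : ER) : ER :=
  match x, y with Some a, Some b => Some (Rplus a b) | _, _ => None end.
Definition er_min (x y : ER) : ER :=
  match x, y with
  | None, y => y | x, None => x | Some a, Some b => Some (Rmin a b) end.
Definition er_le (x y : ER) : Prop :=
  match x, y with
  | _, None => True | None, Some _ => False | Some a, Some b => Rle a b end.

Definition pset (T : Type) := T -> Prop.

Inductive gen_open (T : Type) (S : pset T -> Prop) : pset T -> Prop :=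
| go_base U : S U -> gen_open S U
| go_full : gen_open S (fun _ => True)
| go_inter U V : gen_open S U -> gen_open S V -> gen_open S (fun x => U x /\ V x)
| go_union (P : pset T -> Prop) :
    (forall U, P U -> gen_open S U) -> gen_open S (fun x => exists U, P U /\ U x).

Definition generated (T : Type) (S : pset T -> Prop) (U : pset T) : Prop :=
  exists V, gen_open S V /\ forall x, U x <-> V x.

Definition initial (T I Y : Type) (openY : pset Y -> Prop) (g : I -> T -> Y)
  : pset T -> Prop :=
  generated (fun U => exists i V, openY V /\ forall x, U x <-> V (g i x)).

Definition continuous (X Y : Type) (openX : pset X -> Prop) (openY : pset Y -> Prop)
  (f : X -> Y) : Prop :=
  forall V, openY V -> openX (fun x => V (f x)).

Definition in_closure (T : Type) (openT : pset T -> Prop) (S : pset T) (x : T) : Prop :=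
  forall U, openT U -> U x -> exists y, S y /\ U y.

Definition open_R (U : pset R) : Prop :=
  forall x, U x -> exists eps, Rlt (IZR 0) eps /\
    forall y, Rlt (Rabs (Rminus y x)) eps -> U y.

Definition open_ER (U : pset ER) : Prop :=
  forall x, U x ->
    match x with
    | Some r => exists eps, Rlt (IZR 0) eps /\
                  forall y, Rlt (Rabs (Rminus y r)) eps -> U (Some y)
    | None => exists a, forall y, Rlt a y -> U (Some y)
    end.

Definition open_ERn (m : nat) : pset ('I_m -> ER) -> Prop :=
  initial open_ER (fun (i : 'I_m) (v : 'I_m -> ER) => v i).

Section Valuation.
Variables (K : fieldType) (nu : K -> ER).

Definition absv (a : K) : R :=
  match nu a with None => IZR 0 | Some r => Rtrigo_def.exp (Ropp r) end.

Definition nonarch_valuation : Prop :=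
  [/\ nu 0 = None,
      (forall a, a <> 0 -> nu a <> None),
      (forall a b, nu (a * b) = er_add (nu a) (nu b)) &
      (forall a b, er_le (er_min (nu a) (nu b)) (nu (a + b)))].

Definition nontrivial_valuation : Prop :=
  exists a, a <> 0 /\ nu a <> Some (IZR 0).

Definition complete_valuation : Prop :=
  forall u : nat -> K,
    (forall eps, Rlt (IZR 0) eps -> exists N : nat, forall p q : nat, leq N p -> leq N q ->
        Rlt (absv (u p - u q)) eps) ->
    exists l, forall eps, Rlt (IZR 0) eps -> exists N : nat, forall n : nat, leq N n ->
        Rlt (absv (u n - l)) eps.
End Valuation.

Inductive pexpr (K : Type) (m : nat) : Type :=
| PC of K
| PX of 'I_m
| PAdd of pexpr K m & pexpr K m
| PMul of pexpr K m & pexpr K m.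

Fixpoint peval (K : Type) (Rg : pzRingType) (m : nat) (s : K -> Rg) (v : 'I_m -> Rg)
  (p : pexpr K m) : Rg :=
  match p with
  | PC c => s c
  | PX i => v i
  | PAdd p q => peval s v p + peval s v q
  | PMul p q => peval s v p * peval s v q
  end.

Unset Implicit Arguments.
Section Variety.
Variables (K : closedFieldType) (nu : K -> ER) (A : comAlgType K).

Definition generates (m : nat) (f : 'I_m -> A) : Prop :=
  forall a : A, exists p : pexpr K m, a = peval (fun c => c%:A) f p.

(* K[X] of an affine variety X: finitely generated K-algebra which is a domain *)
Definition affine_coordinate_ring : Prop :=
  [/\ (exists m (f : 'I_m -> A), generates m f),
      (1 : A) <> 0 &
      (forall a b : A, a * b = 0 -> a = 0 \/ b = 0)].

(* affine embeddings  X -> A^m  (given by generators f_1..f_m of K[X]) *)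
Definition Emb := {m : nat & {f : 'I_m -> A | generates m f}}.
Definition edim (e : Emb) : nat := projT1 e.
Definition egen (e : Emb) : 'I_(edim e) -> A := proj1_sig (projT2 e).

Definition is_Kpoint (x : A -> K) : Prop :=
  [/\ x 1 = 1,
      (forall a b, x (a + b) = x a + x b),
      (forall a b, x (a * b) = x a * x b) &
      (forall c, x (c%:A) = c)].

Definition is_seminorm (s : A -> R) : Prop :=
  (forall a, Rle (IZR 0) (s a)) /\
  [/\ s 0 = IZR 0, s 1 = IZR 1,
      (forall a b, s (a * b) = Rmult (s a) (s b)),
      (forall a b, Rle (s (a + b)) (Rplus (s a) (s b))) &
      (forall c, s (c%:A) = absv nu c)].

Definition Xan := {s : A -> R | is_seminorm s}.
Definition open_Xan : pset Xan -> Prop :=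
  initial open_R (fun (f : A) (x : Xan) => proj1_sig x f).

Definition nlog (r : R) : ER :=
  if Req_EM_T r (IZR 0) then None else Some (Ropp (ln r)).

Definition pi_emb (e : Emb) (x : Xan) : 'I_(edim e) -> ER :=
  fun i => nlog (proj1_sig x (egen e i)).

Definition Trop_emb (e : Emb) : pset ('I_(edim e) -> ER) :=
  in_closure (@open_ERn (edim e))
    (fun v => exists x, is_Kpoint x /\ forall i, v i = nu (x (egen e i))).


Definition torus (m : nat) (t : 'I_m -> K) : Prop := forall i, t i <> 0.
Definition equivariant (m n : nat) (phi : 'I_n -> pexpr K m) : Prop :=
  exists h : ('I_m -> K) -> ('I_n -> K),
    [/\ (forall t, torus m t -> torus n (h t)),
        (forall t t', torus m t -> torus m t' ->
            forall j, h (fun i => t i * t' i) j = h t j * h t' j) &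
        (forall t, torus m t -> forall (y : 'I_m -> K) j,
            peval (fun c : K => c) (fun i => t i * y i) (phi j) = h t j * peval (fun c : K => c) y (phi j))].

Definition Fam := forall e : Emb, 'I_(edim e) -> ER.
Definition open_Fam : pset Fam -> Prop :=
  initial open_ER (fun (k : {e : Emb & 'I_(edim e)}) (p : Fam) => p (projT1 k) (projT2 k)).

(* compatibility with all maps Trop(phi): Trop(phi) is the continuous map
   with Trop(phi(y)) = Trop(phi)(Trop(y)) for y in A^m(K). *)
Definition compatible (p : Fam) : Prop :=
  forall (e1 e2 : Emb) (phi : 'I_(edim e2) -> pexpr K (edim e1)),
    equivariant (edim e1) (edim e2) phi ->
    (forall j, egen e2 j = peval (fun c => c%:A) (egen e1) (phi j)) ->
    forall F : ('I_(edim e1) -> ER) -> ('I_(edim e2) -> ER),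
      continuous (@open_ERn (edim e1)) (@open_ERn (edim e2)) F ->
      (forall (y : 'I_(edim e1) -> K) j,
          nu (peval (fun c : K => c) y (phi j)) = F (fun i => nu (y i)) j) ->
      forall j, p e2 j = F (p e1) j.

Definition in_lim (p : Fam) : Prop := (forall e, Trop_emb e (p e)) /\ compatible p.

Definition lim_pi (x : Xan) : Fam := fun e => pi_emb e x.
End Variety.

Arguments generates {K A m}.
Arguments affine_coordinate_ring {K} A.
Arguments Emb {K} A.
Arguments edim {K A}.
Arguments egen {K A}.
Arguments is_Kpoint {K A}.
Arguments is_seminorm {K} nu {A}.
Arguments Xan {K} nu A.
Arguments open_Xan {K} nu A.
Arguments pi_emb {K nu A}.
Arguments Trop_emb {K} nu {A}.
Arguments equivariant {K m n}.
Arguments Fam {K} A.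
Arguments open_Fam {K} A.
Arguments compatible {K} nu {A}.
Arguments in_lim {K} nu {A}.
Arguments lim_pi {K nu A}.

(* Main.v *)
(* The substantial point is that tropicalizations of K-points approximate every
   point of X^an; everything else is formal, because a point of X^an is recovered
   from its coordinates in embeddings having prescribed functions among the generators,
   and each axiom of a seminorm, as well as each compatibility with Trop(phi), is a
   closed condition on the tropicalization of one large enough embedding.

   For the approximation, a multiplicative seminorm on K[X] is pulled back from an
   absolute value v on a field L, and L is reached from K by adjoining the images t of
   the generators one at a time, approximating v on K[t_1, ..., t_k] by K-points at
   each stage.  If t is algebraic, with relation p(t) = 0, the norm of h(t) is controlled
   by the coefficients of the characteristic polynomial of h, a resultant, which are already
   approximated; applying this to many combinations of given functions at once and using
   the pigeonhole principle yields one root of the specialized p that is good for all of them.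
   If t is transcendental, v is extended to a field over which the finitely many
   polynomials to be approximated split, their roots are adjoined by the algebraic case,
   and a value of t is chosen at the right distances from the specialized roots.
   The extension of v to an algebraic extension is Chevalley's: a maximal subring lying
   over the valuation ring is a valuation ring, and its gauge is multiplicative
   because the values of v are dense. *)
Require Import Defs.
From HB Require Import structures.
From Stdlib Require Import Reals.
From mathcomp Require Import all_boot all_order all_algebra all_field.
From mathcomp Require Import boolp classical_sets reals Rstruct.
From mathcomp Require Import ring lra.

Set Implicit Arguments.
Unset Strict Implicit.
Unset Printing Implicit Defensive.

Import Order.TTheory GRing.Theory Num.Theory.
Local Open Scope ring_scope.

(** * Ultrametric seminorms *)

Section RealPreliminaries.
Variable R : realType.
Implicit Types x y z t l m : R.

Lemma exp_unbounded x y : 1 < x -> exists n, y < x ^+ n.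
Proof.
move=> x1; exists (Num.bound `|y / (x - 1)|).
set n := Num.bound _.
have hn : y < n%:R * (x - 1).
  rewrite -ltr_pdivrMr ?subr_gt0 //; apply: le_lt_trans (ler_norm _) _.
  exact: archi_boundP.
have key k : 1 + k%:R * (x - 1) <= x ^+ k.
  elim: k => [|k IH]; first by rewrite expr0 mul0r addr0.
  rewrite exprS -natr1.
  have : x * (1 + k%:R * (x - 1)) <= x * x ^+ k by rewrite ler_pM2l //; lra.
  apply: le_trans.
  have : 0 <= k%:R * (x - 1) * (x - 1) by rewrite !mulr_ge0 //; lra.
  by lra.
by have := key n; lra.
Qed.

(** Iterated square roots replace an exact root. This splits a tolerance [l] into [n] equal factors
    still greater than [1]. *)
Lemma exists_root_lower l n : 1 < l -> exists m : R, 1 < m /\ m ^+ n <= l.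
Proof.
elim: n l => [|n IH] l l1; first by exists l; split => //; rewrite expr0 ltW.
have s1 : 1 < Num.sqrt l by rewrite -[ltLHS]sqrtr1 ltr_sqrt //; lra.
have [m [m1 mn]] := IH _ s1.
exists (Num.min m (Num.sqrt l)); split; first by rewrite lt_min m1.
rewrite exprS -[leRHS](@sqr_sqrtr _ l); last by lra.
rewrite expr2; apply: ler_pM; rewrite ?exprn_ge0 ?le_min ?ge_min ?lexx ?orbT //.
- by apply/andP; split; lra.
- by apply/andP; split; lra.
apply: le_trans mn; apply: lerXn2r; rewrite ?nnegrE ?le_min ?ge_min ?lexx //.
  by apply/andP; split; lra.
by lra.
Qed.

Lemma le_limit_scale x y : 0 <= y -> (forall l, 1 < l -> x <= l * y) -> x <= y.
Proof.
move=> y0 h; rewrite leNgt; apply/negP => xy.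
have [y00|yn] := eqVneq y 0.
  by have := h 2; rewrite y00 mulr0 in xy *; move=> /(_ (ltr1n _ 2)); lra.
have yp : 0 < y by rewrite lt_def yn.
(* The midpoint of [1] and [x / y]: an admissible scale, yet too small for the bound it would
   give. *)
have := h ((x / y + 1) / 2).
have -> : (x / y + 1) / 2 * y = (x + y) / 2 by field.
have : 1 < x / y by rewrite ltr_pdivlMr // mul1r.
move=> h1 H; have h2 : 1 < (x / y + 1) / 2 by lra.
by have := H h2; lra.
Qed.

(** A multiplicative error. For nonnegative numbers, closeness to [0] forces equality with [0]. *)
Definition close l x y := x <= l * y /\ y <= l * x.

Lemma close_refl l x : 1 <= l -> 0 <= x -> close l x x.
Proof. by move=> l1 x0; split; rewrite ler_peMl. Qed.

Lemma close_mul l m x y z t : 0 <= l -> 0 <= m ->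
  0 <= x -> 0 <= y -> 0 <= z -> 0 <= t ->
  close l x y -> close m z t -> close (l * m) (x * z) (y * t).
Proof.
move=> l0 m0 x0 y0 z0 t0 [a b] [c d].
by split; rewrite mulrACA; apply: ler_pM.
Qed.

Lemma close_weaken l m x y : l <= m -> 0 <= x -> 0 <= y -> close l x y -> close m x y.
Proof.
by move=> lm x0 y0 [a b]; split; [apply: (le_trans a)|apply: (le_trans b)];
  apply: ler_wpM2r.
Qed.

Lemma close_max l x y z t : 0 <= l -> close l x y -> close l z t ->
  close l (Num.max x z) (Num.max y t).
Proof.
move=> l0 [a b] [c d]; split; rewrite maxr_pMr // ge_max !le_max.
  by rewrite a c orbT.
by rewrite b d orbT.
Qed.

End RealPreliminaries.

Section Seminorm.
Variable R : realType.

Definition mulseminorm (B : nzRingType) (v : B -> R) : Prop :=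
  [/\ v 0 = 0, v 1 = 1, forall x, 0 <= v x,
      {morph v : x y / x * y >-> x * y} &
      forall x y, v (x + y) <= Num.max (v x) (v y)].

Section Theory.
Variables (B : nzRingType) (v : B -> R).
Hypothesis hv : mulseminorm v.

Lemma msn0 : v 0 = 0. Proof. by case: hv. Qed.
Lemma msn1 : v 1 = 1. Proof. by case: hv. Qed.
Lemma msn_ge0 x : 0 <= v x. Proof. by case: hv. Qed.
Lemma msnM x y : v (x * y) = v x * v y. Proof. by case: hv => ? ? ? ->. Qed.
Lemma msnD x y : v (x + y) <= Num.max (v x) (v y). Proof. by case: hv. Qed.

Lemma msnN x : v (- x) = v x.
Proof.
rewrite -mulN1r msnM; suff -> : v (- 1) = 1 by rewrite mul1r.
have : v (-1) * v (-1) = 1 by rewrite -msnM mulrNN mulr1 msn1.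
have := msn_ge0 (-1); move: (v (-1)) => a a0 aa.
apply/eqP; rewrite eq_le; apply/andP; split; nra.
Qed.

Lemma msnBC x y : v (x - y) = v (y - x).
Proof. by rewrite -opprB msnN. Qed.

Lemma msnX x n : v (x ^+ n) = v x ^+ n.
Proof. by elim: n => [|n IH]; rewrite ?expr0 ?msn1 // !exprS msnM IH. Qed.

Lemma msnD_lt x y r : v x < r -> v y < r -> v (x + y) < r.
Proof. by move=> a b; apply: le_lt_trans (msnD x y) _; rewrite gt_max a. Qed.

Lemma msnD_le x y r : v x <= r -> v y <= r -> v (x + y) <= r.
Proof. by move=> a b; apply: le_trans (msnD x y) _; rewrite ge_max a. Qed.

Lemma msnB_le x y r : v x <= r -> v y <= r -> v (x - y) <= r.
Proof. by move=> a b; apply: msnD_le; rewrite ?msnN. Qed.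

Lemma msnD_eqr x y : v x < v y -> v (x + y) = v y.
Proof.
move=> h; apply/eqP; rewrite eq_le msnD_le ?(ltW h) //=.
rewrite leNgt; apply/negP => h2.
have : v (x + y - x) < v y by apply: msnD_lt => //; rewrite msnN.
by rewrite addrC addKr ltxx.
Qed.

Lemma msn_sum (I : Type) (r : seq I) (P : pred I) (F : I -> B) c : 0 <= c ->
  (forall i, P i -> v (F i) <= c) -> v (\sum_(i <- r | P i) F i) <= c.
Proof.
move=> c0 h; elim/big_ind: _ => //; first by rewrite msn0.
by move=> x y; apply: msnD_le.
Qed.

Lemma msn_sum_lt (I : Type) (r : seq I) (P : pred I) (F : I -> B) c : 0 < c ->
  (forall i, P i -> v (F i) < c) -> v (\sum_(i <- r | P i) F i) < c.
Proof.
move=> c0 h; elim/big_ind: _ => //; first by rewrite msn0.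
by move=> x y; apply: msnD_lt.
Qed.

Lemma msn_nat n : v n%:R <= 1.
Proof.
by elim: n => [|n IH]; rewrite ?msn0 ?ler01 // -natr1 msnD_le ?msn1.
Qed.

End Theory.

Lemma msn_prod (B : comNzRingType) (v : B -> R) (I : Type) (r : seq I) (F : I -> B) :
  mulseminorm v -> v (\prod_(i <- r) F i) = \prod_(i <- r) v (F i).
Proof.
by move=> hv; elim/big_rec2: _ => [|i y x _ <-]; rewrite ?(msn1 hv) // (msnM hv).
Qed.

Lemma mulseminorm_comp (B C : nzRingType) (f : {rmorphism B -> C}) (v : C -> R) :
  mulseminorm v -> mulseminorm (v \o f).
Proof.
move=> hv; split => [|||x y|x y] /=.
- by rewrite rmorph0 (msn0 hv).
- by rewrite rmorph1 (msn1 hv).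
- by move=> x; apply: msn_ge0.
- by rewrite rmorphM (msnM hv).
- by rewrite rmorphD (msnD hv).
Qed.

Section Field.
Variables (F : fieldType) (v : F -> R).
Hypothesis hv : mulseminorm v.

Lemma msn_neq0 x : x != 0 -> v x != 0.
Proof.
move=> x0; apply/eqP => h; have := msnM hv x x^-1.
by rewrite h mul0r mulfV // (msn1 hv) => /eqP; rewrite oner_eq0.
Qed.

Lemma msn_eq0 x : (v x == 0) = (x == 0).
Proof.
apply/idP/idP => [|/eqP->]; last by rewrite (msn0 hv).
by apply: contraLR => /msn_neq0.
Qed.

Lemma msn_gt0 x : x != 0 -> 0 < v x.
Proof. by move=> x0; rewrite lt_def msn_neq0 // (msn_ge0 hv). Qed.

Lemma msnV x : v x^-1 = (v x)^-1.
Proof.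
have [->|x0] := eqVneq x 0; first by rewrite invr0 (msn0 hv) invr0.
apply: (mulfI (msn_neq0 x0)).
by rewrite -(msnM hv) !mulfV ?(msn1 hv) // msn_neq0.
Qed.

End Field.

Definition dense_values (F : fieldType) (v : F -> R) : Prop :=
  forall r l : R, 0 < r -> 1 < l -> exists a, r <= v a /\ v a <= l * r.

End Seminorm.

Lemma prod_const_seq (B : comNzRingType) (I : Type) (s : seq I) (c : B) :
  \prod_(x <- s) c = c ^+ size s.
Proof. by rewrite big_const_seq count_predT; elim: (size s) => //= n ->; rewrite exprS. Qed.

(** * Algebraically closed valued fields: density of values, separated points, sizes of roots *)

Section ClosedField.
Variables (R : realType) (K : closedFieldType) (w : K -> R).
Hypothesis hw : mulseminorm w.

Lemma closed_root_exists (p : {poly K}) : (1 < size p)%N -> exists x, root p x.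
Proof. by move=> h; apply/closed_rootP; rewrite neq_ltn h orbT. Qed.

(** An [n]-th root [c] of an element of value above [1] has [1 < w c < l] for large [n], and the
    powers of [c] leave no gap of ratio [l]. *)
Lemma dense_values_closed : (exists a, a != 0 /\ w a != 1) -> dense_values w.
Proof.
move=> [a0 [a00 a01]].
have [a a1] : exists a, 1 < w a.
  have [h|h] := ltP 1 (w a0); first by exists a0.
  exists a0^-1; rewrite (msnV hw) invf_gt1 ?(msn_gt0 hw) //.
  by rewrite lt_neqAle a01.
move=> r l r0 l1.
have [n hn] := exp_unbounded (w a) l1.
have n0 : (0 < n)%N.
  by case: n hn => //; rewrite expr0 => h; have := lt_trans a1 h; rewrite ltxx.
have [c /eqP hc] : exists c, root ('X^n - a%:P) c.
  by apply: closed_root_exists; rewrite size_XnsubC.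
have wc : w c ^+ n = w a.
  by rewrite -(msnX hw); congr w; move: hc; rewrite !hornerE ?hornerXn => /eqP;
     rewrite subr_eq0 => /eqP.
have c1 : 1 < w c.
  rewrite ltNge; apply/negP => h; have := @exprn_ile1 _ n _ (msn_ge0 hw c) h.
  by rewrite wc; lra.
have cl : w c < l.
  rewrite ltNge; apply/negP => h.
  have : l ^+ n <= w c ^+ n by rewrite lerXn2r ?nnegrE ?(msn_ge0 hw) //; lra.
  by rewrite wc; lra.
have cn0 : c != 0 by apply/eqP => h; move: c1; rewrite h (msn0 hw); lra.
have [k hk] := exp_unbounded r^-1 c1.
have lo : (w c ^+ k)^-1 < r by rewrite invf_plt ?posrE ?exprn_gt0 //; lra.
have [m hm] := exp_unbounded (r * w c ^+ k) c1.
have ck0 : 0 < w c ^+ k by rewrite exprn_gt0 //; lra.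
(* The factor [w c ^+ k] lifts [r] above [1], so exponents in [nat] suffice; the least one
   overshoots by at most [w c < l]. *)
have ex : exists m, r * w c ^+ k <= w c ^+ m by exists m; exact: ltW.
case: (ex_minnP ex) => j hj jmin.
exists (c ^+ j / c ^+ k); rewrite (msnM hw) (msnV hw) !(msnX hw); split.
  by rewrite ler_pdivlMr.
rewrite ler_pdivrMr //; case: j hj jmin => [|j] hj jmin.
  rewrite expr0; have : 1 <= r * w c ^+ k by rewrite -ler_pdivrMr // div1r ltW.
  by move=> h; rewrite -mulrA; nra.
rewrite exprS; have : w c ^+ j < r * w c ^+ k.
  by rewrite ltNge; apply/negP => /jmin; rewrite ltnn.
move=> h; rewrite -mulrA; apply: ler_pM; rewrite ?exprn_ge0 ?(ltW h) ?(ltW cl) //; lra.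
Qed.

(* [b] is a root of [\prod_(x <- s') ('X - x%:P) - (c ^+ size s')%:P]: no factor exceeds
   [w c] at [b], and their product has value [w c ^+ size s']. *)
Lemma generic_element (s : seq K) (c : K) : c != 0 ->
  exists b, w b <= w c /\ forall x, x \in s -> w c <= w (b - x).
Proof.
move=> c0; have c0' := msn_gt0 hw c0.
(* The entry [0] keeps the product nonconstant. Points larger than [c] are left out, being far from
   any [b] with [w b <= w c]. *)
pose s' := 0 :: [seq x <- s | w x <= w c].
pose p := \prod_(x <- s') ('X - x%:P) - (c ^+ size s')%:P.
have [b] : exists b, root p b.
  apply: closed_root_exists; rewrite size_polyDl ?size_prod_XsubC //.
  by rewrite size_polyN size_polyC; case: (_ != 0).
rewrite /root /p !hornerE horner_prod subr_eq0 => /eqP hb.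
have {}hb : \prod_(x <- s') w (b - x) = w c ^+ size s'.
  rewrite -(msnX hw) -hb (msn_prod _ _ hw); apply: eq_bigr => x _.
  by rewrite hornerXsubC.
have s'c x : x \in s' -> w x <= w c.
  by rewrite inE => /orP[/eqP->|]; rewrite ?(msn0 hw) ?(ltW c0') // mem_filter => /andP[].
have bc : w b <= w c.
  rewrite leNgt; apply/negP => h.
  have : w c ^+ size s' < w b ^+ size s'.
    by rewrite ltrXn2r ?(msn_ge0 hw) ?h ?andbT.
  rewrite -hb => {hb} H.
  suff E : \prod_(x <- s') w (b - x) = w b ^+ size s' by move: H; rewrite E ltxx.
  rewrite -prod_const_seq; apply: eq_big_seq => x /s'c xc.
  by rewrite addrC (msnD_eqr hw) // (msnN hw) (le_lt_trans xc).
exists b; split => // x xs.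
have [xc|xc] := leP (w x) (w c); last first.
  by rewrite (msnD_eqr hw) (msnN hw) ?(ltW xc) // (le_lt_trans bc).
have xs' : x \in s' by rewrite inE mem_filter xc xs orbT.
rewrite leNgt; apply/negP => lt.
have E : \prod_(y <- s') w (b - y) = w (b - x) * \prod_(y <- rem x s') w (b - y).
  by rewrite (perm_big _ (perm_to_rem xs')) big_cons.
have : \prod_(y <- rem x s') w (b - y) <= w c ^+ size (rem x s').
  rewrite -prod_const_seq big_seq [leRHS]big_seq; apply: ler_prod => y /mem_rem ys.
  by rewrite (msn_ge0 hw) (msnB_le hw) // s'c.
rewrite (size_rem xs') => le.
have : w (b - x) * \prod_(y <- rem x s') w (b - y) < w c ^+ size s'.
  apply: (@le_lt_trans _ _ (w (b - x) * w c ^+ (size s').-1)).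
    by rewrite ler_wpM2l ?(msn_ge0 hw).
  by rewrite -[in ltRHS](@prednK (size s')) // exprS ltr_pM2r // exprn_gt0.
by rewrite -E hb ltxx.
Qed.

(** This expresses that the residue field is infinite: each new point comes from [generic_element]
    with [c := 1]. *)
Lemma separated_units n : exists s : seq K,
  [/\ size s = n, forall x, x \in s -> w x <= 1 &
      pairwise (fun x y => w (x - y) == 1) s].
Proof.
elim: n => [|n [s [sn s1 sp]]]; first by exists [::].
have [b [b1 bs]] := generic_element s (oner_neq0 K).
rewrite (msn1 hw) in b1 bs.
exists (b :: s); split => /=; first by rewrite sn.
  by move=> x; rewrite inE => /orP[/eqP->|/s1].
rewrite sp andbT; apply/allP => x xs.
by rewrite eq_le (bs _ xs) (msnB_le hw) // s1.
Qed.

(** A Newton polygon estimate, by induction on the linear factors: both terms of [q]_k - x *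
    q[_k.+1] obey the bound since [m <= w x]. *)
Lemma coef_root_bound (p : {poly K}) (m : R) k : 0 < m ->
  (forall x, root p x -> m <= w x) -> w p`_k * m ^+ k <= w p`_0.
Proof.
move=> m0; have [r ->] := closed_field_poly_normal p.
have [->|lp] := eqVneq (lead_coef p) 0.
  by rewrite scale0r !coef0 (msn0 hw) mul0r.
move=> h; have {}h x : x \in r -> m <= w x.
  by move=> xr; apply: h; rewrite rootZ // root_prod_XsubC.
rewrite !coefZ !(msnM hw) -mulrA ler_pM2l ?(msn_gt0 hw) // => {lp}.
elim: r h k => [|x r IH] h k.
  rewrite big_nil !coef1; case: k => [|k]; first by rewrite expr0 mulr1.
  by rewrite (msn0 hw) mul0r (msn_ge0 hw).
rewrite big_cons; set q := \prod_(_ <- _) _ in IH *.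
have {}IH j : w q`_j * m ^+ j <= w q`_0 by apply: IH => y yr; apply: h; rewrite inE yr orbT.
have mx : m <= w x by apply: h; rewrite mem_head.
have E0 : (('X - x%:P) * q)`_0 = - (x * q`_0).
  by rewrite mulrBl coefB coefXM coefCM eqxx sub0r.
rewrite E0 (msnN hw) (msnM hw).
case: k => [|k]; first by rewrite E0 (msnN hw) (msnM hw) expr0 mulr1.
rewrite mulrBl coefB coefXM coefCM /=.
rewrite -ler_pdivlMr ?exprn_gt0 //; apply: (msnB_le hw); rewrite ler_pdivlMr ?exprn_gt0 //.
  rewrite exprS mulrCA; apply: ler_pM => //; first exact: ltW.
  by rewrite mulr_ge0 ?(msn_ge0 hw) // exprn_ge0 // ltW.
by rewrite (msnM hw) -mulrA ler_wpM2l ?(msn_ge0 hw).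
Qed.

End ClosedField.

(* The Vandermonde matrix of the points of [s] is invertible over the valuation ring. *)
Lemma interpolation_bound (R : realType) (F : fieldType) (w : F -> R)
    (s : seq F) (p : {poly F}) (c : R) : mulseminorm w -> 0 <= c ->
  (forall x, x \in s -> w x <= 1) -> pairwise (fun x y => w (x - y) == 1) s ->
  (size p <= size s)%N -> (forall x, x \in s -> w p.[x] <= c) ->
  forall k, w p`_k <= c.
Proof.
move=> hw c0; elim: s p => [|x s IH] p s1 sp ps hp k.
  by move: ps; rewrite leqn0 size_poly_eq0 => /eqP->; rewrite coef0 (msn0 hw).
(* Newton interpolation: [q] is the divided difference of [p] at [x]. Its values at the other points
   keep the bound [c] because the divisors [y - x] have value [1]. *)
have [q pq] : exists q, p = q * ('X - x%:P) + (p.[x])%:P.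
  have : root (p - (p.[x])%:P) x by rewrite /root !hornerE subrr.
  by move=> /factor_theorem[q hq]; exists q; rewrite -hq subrK.
move: sp => /= /andP[/allP sx sp].
have x1 : w x <= 1 by rewrite s1 ?mem_head.
have sq : (size q <= size s)%N.
  have [->|q0] := eqVneq q 0; first by rewrite size_poly0.
  rewrite -ltnS; apply: leq_trans ps.
  have : size (q * ('X - x%:P)) = (size q).+1 by rewrite size_mul ?polyXsubC_eq0 // size_XsubC addn2.
  move=> E; rewrite pq size_polyDl E // ltnS.
  by apply: leq_trans (size_polyC_leq1 _) _; rewrite size_poly_gt0.
have hq j : w q`_j <= c.
  apply: IH => // [y ys|y ys]; first by rewrite s1 // inE ys orbT.
  have := hp y; rewrite inE ys orbT => /(_ isT).
  have yx : w (y - x) = 1 by rewrite (msnBC hw); apply/eqP/sx.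
  have : w (q.[y] * (y - x)) = w q.[y] by rewrite (msnM hw) yx mulr1.
  have -> : q.[y] * (y - x) = p.[y] - p.[x].
    by rewrite [in p.[y]]pq !hornerE addrK.
  by move=> <- h; apply: (msnB_le hw) => //; apply: hp; rewrite mem_head.
rewrite pq coefD mulrBr coefB coefMX coefMC coefC.
apply: (msnD_le hw); last by case: eqP => _; rewrite ?(msn0 hw) ?hp ?mem_head.
apply: (msnB_le hw); first by case: eqP => _; rewrite ?(msn0 hw).
by rewrite (msnM hw) -[leRHS]mulr1 ler_pM ?(msn_ge0 hw).
Qed.

(** * Extension of absolute values *)

Section ValuationExtension.
Variables (R : realType) (F E : fieldType) (j : {rmorphism F -> E}) (v : F -> R).
Hypothesis hv : mulseminorm v.

Definition is_subring (V : set E) : Prop :=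
  [/\ V 1, forall x y, V x -> V y -> V (x - y) & forall x y, V x -> V y -> V (x * y)].

(* [V] is a subring of [E] lying over the valuation ring of [F]; the maximal ones are valuation rings. *)
Definition lies_over (V : set E) : Prop :=
  is_subring V /\ forall a, V (j a) <-> v a <= 1.

Section Subring.
Variable V : set E.
Hypothesis sV : is_subring V.

Lemma sr1 : V 1. Proof. by case: sV. Qed.
Lemma srB x y : V x -> V y -> V (x - y). Proof. by case: sV => _ + _; apply. Qed.
Lemma srM x y : V x -> V y -> V (x * y). Proof. by case: sV => _ _; apply. Qed.
Lemma sr0 : V 0. Proof. by rewrite -(subrr 1); apply: srB; exact: sr1. Qed.
Lemma srN x : V x -> V (- x). Proof. by rewrite -sub0r; apply: srB; exact: sr0. Qed.
Lemma srD x y : V x -> V y -> V (x + y).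
Proof. by move=> a b; rewrite -(opprK y); apply: srB => //; apply: srN. Qed.
Lemma sr_sum (I : Type) (r : seq I) (P : pred I) (f : I -> E) :
  (forall i, P i -> V (f i)) -> V (\sum_(i <- r | P i) f i).
Proof. by move=> h; elim/big_ind: _ => //; [exact: sr0|exact: srD]. Qed.
Lemma srX x n : V x -> V (x ^+ n).
Proof.
by move=> h; elim: n => [|n IH]; [rewrite expr0; exact: sr1|rewrite exprS; apply: srM].
Qed.

Definition poly_over (p : {poly E}) : Prop := forall i, V p`_i.

Lemma poly_overC c : V c -> poly_over c%:P.
Proof. by move=> h i; rewrite coefC; case: eqP => // _; exact: sr0. Qed.
Lemma poly_overB p q : poly_over p -> poly_over q -> poly_over (p - q).
Proof. by move=> a b i; rewrite coefB; apply: srB. Qed.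
Lemma poly_overD p q : poly_over p -> poly_over q -> poly_over (p + q).
Proof. by move=> a b i; rewrite coefD; apply: srD. Qed.
Lemma poly_overM p q : poly_over p -> poly_over q -> poly_over (p * q).
Proof. by move=> a b i; rewrite coefM; apply: sr_sum => k _; apply: srM. Qed.
Lemma poly_overX : poly_over 'X.
Proof. by move=> i; rewrite coefX; case: eqP => _; [exact: sr1|exact: sr0]. Qed.

Lemma poly_over_det n (M : 'M[{poly E}]_n) :
  (forall i k, poly_over (M i k)) -> poly_over (\det M).
Proof.
move=> h; have h1 : poly_over 1 by apply: poly_overC; exact: sr1.
have h0 : poly_over 0 by apply: poly_overC; exact: sr0.
rewrite /determinant; elim/big_ind: _ => //; first exact: poly_overD.
move=> s _; apply: poly_overM.
  by case: (perm.odd_perm s); rewrite ?expr0 // expr1 -sub0r; apply: poly_overB.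
by elim/big_ind: _ => //; exact: poly_overM.
Qed.

Definition adjoin (x : E) : set E := fun y => exists p, poly_over p /\ y = p.[x].

Lemma adjoin_subring x : is_subring (adjoin x).
Proof.
split.
- by exists 1; split; [apply: poly_overC; exact: sr1|rewrite hornerC].
- move=> _ _ [p [hp ->]] [q [hq ->]]; exists (p - q).
  by split; [apply: poly_overB|rewrite !hornerE].
- move=> _ _ [p [hp ->]] [q [hq ->]]; exists (p * q).
  by split; [apply: poly_overM|rewrite !hornerE].
Qed.

End Subring.

(** The determinant trick: [j a] is a root of a monic polynomial over [V]. If [1 < v a], dividing by
    a power of [j a] writes [j a] as a [V]-combination of powers of its inverse, which lie in [V],
    so [j a] would lie in [V] too. *)
Lemma lies_over_eigenvalue V n (C : 'M[E]_n) (r : 'rV[E]_n) a : lies_over V ->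
  (forall i k, V (C i k)) -> r != 0 -> r *m C = j a *: r -> v a <= 1.
Proof.
move=> [sV oV] hC r0 rC; rewrite leNgt; apply/negP => a1.
have a0 : a != 0 by apply/eqP => h; move: a1; rewrite h (msn0 hv) ltr10.
have : eigenvalue C (j a) by apply/eigenvalueP; exists r.
rewrite eigenvalue_root_char /root horner_coef size_char_poly big_ord_recr /=.
have -> : (char_poly C)`_n = 1.
  by have /monicP := char_poly_monic C; rewrite lead_coefE size_char_poly.
rewrite mul1r addrC addr_eq0 => /eqP E1.
have pV : poly_over V (char_poly C).
  apply: poly_over_det => // i k; rewrite !mxE; apply: poly_overB => //.
    by case: (_ == _); rewrite ?mulr1n ?mulr0n; [exact: poly_overX|apply: poly_overC (sr0 sV)].
  by apply: poly_overC.
case: n C r hC r0 rC E1 pV => [|n] C r hC r0 rC E1 pV.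
  by move: r0; rewrite thinmx0 eqxx.
suff : V (j a) by rewrite oV leNgt a1.
have ja0 : j a != 0 by rewrite fmorph_eq0.
have -> : j a = - \sum_(i < n.+1) (char_poly C)`_i * j (a ^- (n - i)).
  apply: (mulIf (expf_neq0 n ja0)); rewrite -exprS E1 mulNr mulr_suml.
  congr (- _); apply: eq_bigr => i _; rewrite -mulrA; congr (_ * _).
  rewrite fmorphV rmorphXn; have i_n : (i <= n)%N by rewrite -ltnS.
  have -> : j a ^+ n = j a ^+ (n - i) * j a ^+ i by rewrite -exprD subnK.
  by rewrite mulKf ?expf_neq0.
apply: srN => //; apply: sr_sum => // i _; apply: srM => //.
by rewrite oV (msnV hv) (msnX hv) invf_le1 ?exprn_gt0 ?exprn_ege1 ?ltW //; lra.
Qed.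

(* [j a] stabilizes the [V]-module spanned by [1, x, ..., x ^+ (m + n)], so it is integral over [V]. *)
Lemma lies_over_two_sided V x a (f g : {poly E}) : lies_over V ->
  poly_over V f -> poly_over V g -> x != 0 -> j a = f.[x] -> j a = g.[x^-1] -> v a <= 1.
Proof.
move=> oV hf hg x0 af ag; have sV := oV.1.
pose n := size f; pose m := size g.
(* Polynomials over [V] representing [j a * x ^+ i]: small [i] use [f]; for larger [i] the factor
   [x ^+ i] absorbs all negative powers of [x] coming from [g]. *)
pose P (i : nat) : {poly E} :=
  if (i < m)%N then 'X^i * f else \poly_(k < i.+1) g`_(i - k).
have Pov i : poly_over V (P i).
  rewrite /P; case: ifP => _ k; last first.
    by rewrite coef_poly; case: ifP => // _; exact: sr0.
  by rewrite coefXnM; case: ifP => // _; exact: sr0.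
have Psz i : (i < (m + n).+1)%N -> (size (P i) <= (m + n).+1)%N.
  rewrite /P => iN; case: ifP => im.
    apply: leq_trans (size_polyMleq _ _) _; rewrite size_polyXn addSn /=.
    by rewrite ltnW // ltnS leq_add2r ltnW.
  by apply: leq_trans (size_poly _ _) _.
have Pev i : (P i).[x] = j a * x ^+ i.
  rewrite /P; case: ltnP => im; first by rewrite !hornerE -af mulrC.
  rewrite horner_poly ag (@horner_coef_wide _ i.+1) ?(leqW im) //.
  rewrite (reindex_inj rev_ord_inj) /= mulr_suml; apply: eq_bigr => k _.
  have ki : (k <= i)%N by rewrite -ltnS.
  rewrite subSS subKn // -mulrA exprVn; congr (_ * _).
  have -> : x ^+ i = x ^+ k * x ^+ (i - k) by rewrite -exprD subnKC.
  by rewrite mulKf ?expf_neq0.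
pose C := \matrix_(k < (m + n).+1, i < (m + n).+1) (P i)`_k.
pose r := \row_(i < (m + n).+1) x ^+ i.
apply: (@lies_over_eigenvalue V _ C r) => //.
- by move=> i k; rewrite mxE; exact: Pov.
- apply/eqP => /rowP/(_ ord0); rewrite !mxE expr0 => /eqP; exact/negP/oner_neq0.
apply/rowP => i; rewrite !mxE -Pev (@horner_coef_wide _ (m + n).+1) ?Psz //.
by apply: eq_bigr => k _; rewrite !mxE mulrC.
Qed.

Lemma lies_over_maximal_exists : exists V, lies_over V /\
  forall W, lies_over W -> (V `<=` W)%classic -> (W `<=` V)%classic.
Proof.
pose Ok V := V = set0 \/ lies_over V.
have base : lies_over (fun y => exists a, v a <= 1 /\ y = j a).
  split; first split.
  - by exists 1; rewrite rmorph1 (msn1 hv).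
  - move=> _ _ [a [a1 ->]] [b [b1 ->]]; exists (a - b).
    by rewrite rmorphB; split => //; apply: (msnB_le hv).
  - move=> _ _ [a [a1 ->]] [b [b1 ->]]; exists (a * b).
    by rewrite rmorphM (msnM hv); split => //; rewrite mulr_ile1 ?(msn_ge0 hv).
  move=> a; split => [[b [b1 /fmorph_inj->]] //|a1]; by exists a.
have [|V [OV max]] := @Zorn_bigcup E Ok.
  move=> C CO tot.
  have [[V0 [CV0 /set0P/eqP V0n]]|noV] := pselect (exists V0, C V0 /\ (V0 !=set0)%classic); last first.
    left; apply/seteqP; split => // x [V CV Vx]; exfalso; apply: noV; exists V.
    by split => //; exists x.
  have isO V x : C V -> V x -> lies_over V.
    by move=> CV Vx; case: (CO _ CV) => // V00; move: Vx; rewrite V00.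
  have V0O : lies_over V0 by case: (CO _ CV0).
  right; split; first split.
  - by exists V0 => //; exact: sr1 V0O.1.
  - move=> x y [V CV Vx] [W CW Wy]; case: (tot _ _ CV CW) => sub.
      by exists W => //; apply: srB => //; [exact: (isO _ _ CW Wy).1|exact: sub].
    by exists V => //; apply: srB => //; [exact: (isO _ _ CV Vx).1|exact: sub].
  - move=> x y [V CV Vx] [W CW Wy]; case: (tot _ _ CV CW) => sub.
      by exists W => //; apply: srM => //; [exact: (isO _ _ CW Wy).1|exact: sub].
    by exists V => //; apply: srM => //; [exact: (isO _ _ CV Vx).1|exact: sub].
  - move=> a; split => [[V CV Va]|a1]; first exact/(isO _ _ CV Va).2.
    by exists V0 => //; exact/V0O.2.
case: OV => [V0|OV].
  exfalso; apply: (max _ _ (or_intror base)); rewrite V0; split => // h.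
  by have := h 1 (sr1 base.1).
exists V; split => // W OW VW x Wx; apply: contrapT => Vx.
by apply: (max W _ (or_intror OW)); split => // /(_ x Wx).
Qed.

(** * The absolute value defined by a maximal subring *)

Section Maximal.
Variable V : set E.
Hypothesis oV : lies_over V.
Hypothesis maxV : forall W, lies_over W -> (V `<=` W)%classic -> (W `<=` V)%classic.
Hypothesis dv : dense_values v.
Hypothesis alg : forall x : E, exists p : {poly F}, p != 0 /\ root (map_poly j p) x.
Let sV := oV.1.

(** Otherwise [adjoin V x] would still lie over the valuation ring, and maximality would put [x]
    into [V]. *)
Lemma maximal_witness x : ~ V x ->
  exists a p, [/\ 1 < v a, poly_over V p & j a = p.[x]].
Proof.
move=> Vx; apply: contrapT => no; apply: Vx.
apply: (maxV (W := adjoin V x)).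
- split; first exact: adjoin_subring.
  move=> a; split => [[p [hp ap]]|a1].
    by rewrite leNgt; apply/negP => a1; apply: no; exists a, p.
  by exists (j a)%:P; rewrite hornerC; split => //; apply: poly_overC => //; apply/oV.2.
- by move=> y Vy; exists y%:P; rewrite hornerC; split => //; apply: poly_overC.
- by exists 'X; rewrite hornerX; split => //; exact: poly_overX.
Qed.

(** If both fail, there are witnesses [a] in [V[x]] and [b] in [V[x^-1]] of value above [1]. The one
    of larger value is scaled to equal the other, which contradicts [lies_over_two_sided]. *)
Lemma maximal_dichotomy x : V x \/ V x^-1.
Proof.
have [|Vx] := pselect (V x); first by left.
have [|Vy] := pselect (V x^-1); first by right.
have x0 : x != 0 by apply/eqP => h; apply: Vx; rewrite h; exact: sr0.
have [a [f [a1 hf af]]] := maximal_witness Vx.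
have [b [g [b1 hg bg]]] := maximal_witness Vy.
have nz c : 1 < v c -> c != 0.
  by move=> c1; apply/eqP => h; move: c1; rewrite h (msn0 hv) ltr10.
have scale c d p : 1 < v c -> v c <= v d -> poly_over V p -> poly_over V (j (c / d) *: p).
  move=> c1 cd hp i; rewrite coefZ; apply: srM => //; apply/oV.2.
  by rewrite (msnM hv) (msnV hv) ler_pdivrMr ?mul1r //; lra.
have ev c d p y : 1 < v d -> j d = p.[y] -> j c = (j (c / d) *: p).[y].
  by move=> /nz d0 h; rewrite hornerZ -h -rmorphM divfK.
case: (leP (v a) (v b)) => [ab|/ltW ba].
  have := lies_over_two_sided oV hf (scale _ _ _ a1 ab hg) x0 af (ev a b g _ b1 bg).
  by lra.
have := lies_over_two_sided oV (scale _ _ _ b1 ba hf) hg x0 (ev b a f _ a1 af) bg.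
by lra.
Qed.

Lemma lies_over_scale x a b : a != 0 -> v a <= v b -> V (x / j a) -> V (x / j b).
Proof.
move=> a0 ab Va; have b0 : b != 0.
  apply: contraTneq ab => ->; rewrite (msn0 hv) -ltNge; exact: msn_gt0.
have -> : x / j b = x / j a * j (a / b).
  by rewrite rmorphM fmorphV mulrA divfK ?fmorph_eq0.
apply: srM => //; apply/oV.2; rewrite (msnM hv) (msnV hv) ler_pdivrMr ?mul1r //.
exact: msn_gt0.
Qed.

(** Algebraicity enters here. If no scalar brings [x] into [V], then every [j a / x] lies in [V];
    dividing the equation of [x] by its top term then puts into [V] some [j b] with [1 < v b]. *)
Lemma gauge_finite x : exists a, a != 0 /\ V (x / j a).
Proof.
apply: contrapT => no.
have inv a : V (j a / x).
  have [->|a0] := eqVneq a 0; first by rewrite rmorph0 mul0r; exact: sr0.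
  case: (maximal_dichotomy (x / j a)) => [h|]; first by exfalso; apply: no; exists a.
  by rewrite invf_div.
have x0 : x != 0.
  apply/eqP => h; apply: no; exists 1; rewrite oner_neq0 h mul0r; split => //; exact: sr0.
have [p [p0 px]] := alg x.
have [b [b2 _]] := dv (r := 2) (l := 2) (ltr0n _ 2) (ltr1n _ 2).
have c0 := lead_coef_eq0 p; rewrite (negPf p0) in c0.
have : (size p).-1 = (size p).-1 by []; move: {2}_.-1 => n sn.
have sp : size p = n.+1 by rewrite -sn prednK // size_poly_gt0.
suff : V (j b) by rewrite oV.2; lra.
have -> : j b = - \sum_(i < n) j (b * p`_i / lead_coef p) / x * x^-1 ^+ (n - i.+1).
  move: px; rewrite /root horner_coef size_map_poly sp big_ord_recr /= coef_map.
  have <- : lead_coef p = p`_n by rewrite lead_coefE sp.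
  rewrite addrC addr_eq0 => /eqP E1.
  have jl0 : j (lead_coef p) != 0 by rewrite fmorph_eq0 c0.
  apply: (mulIf (mulf_neq0 jl0 (expf_neq0 n x0))); rewrite [in LHS]E1 mulrN mulNr.
  congr (- _); rewrite mulr_sumr mulr_suml; apply: eq_bigr => i _.
  rewrite coef_map !rmorphM fmorphV exprVn; have i_n := ltn_ord i.
  have -> : x ^+ n = x ^+ (n - i.+1) * (x * x ^+ i) by rewrite -exprS -exprD subnK.
  by field; rewrite x0 jl0 expf_neq0.
apply: srN => //; apply: sr_sum => // i _; apply: srM => //.
by apply: srX => //; have := inv 1; rewrite rmorph1 div1r.
Qed.

Definition gauge x : R := inf (fun r => exists a, [/\ a != 0, V (x / j a) & r = v a]).

Lemma gauge_nonempty x :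
  ((fun r => exists a, [/\ a != 0, V (x / j a) & r = v a]) !=set0)%classic.
Proof. by have [a [a0 Va]] := gauge_finite x; exists (v a), a. Qed.

Lemma gauge_le x a : a != 0 -> V (x / j a) -> gauge x <= v a.
Proof.
move=> a0 Va; apply: ge_inf; last by exists a.
by exists 0 => _ [b [_ _ ->]]; exact: msn_ge0.
Qed.

Lemma gauge_lt x r : gauge x < r -> exists a, [/\ a != 0, V (x / j a) & v a < r].
Proof.
move=> h; have [_ [a [a0 Va ->]] ar] := inf_lt (gauge_nonempty x) h.
by exists a.
Qed.

Lemma gauge_ge0 x : 0 <= gauge x.
Proof.
apply: lb_le_inf; first exact: gauge_nonempty.
by move=> _ [b [_ _ ->]]; exact: msn_ge0.
Qed.

Lemma gauge_val b : gauge (j b) = v b.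
Proof.
have [->|b0] := eqVneq b 0.
  rewrite rmorph0 (msn0 hv); apply/eqP; rewrite eq_le gauge_ge0 andbT.
  rewrite leNgt; apply/negP => g0.
  have [a [a1 a2]] := dv (divr_gt0 g0 (ltr0n _ 4)) (ltr1n _ 2).
  have a0 : a != 0.
    by apply/eqP => h; move: a1; rewrite h (msn0 hv); lra.
  have := gauge_le a0 (x := 0); rewrite mul0r => /(_ (sr0 sV)); lra.
apply/eqP; rewrite eq_le; apply/andP; split.
  by apply: gauge_le => //; rewrite divff ?fmorph_eq0 //; exact: sr1.
apply: lb_le_inf; first exact: gauge_nonempty.
move=> _ [a [a0 + ->]]; rewrite -fmorphV -rmorphM => /oV.2.
by rewrite (msnM hv) (msnV hv) ler_pdivrMr ?mul1r //; exact: msn_gt0.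
Qed.

Lemma gaugeM_le x y : gauge (x * y) <= gauge x * gauge y.
Proof.
apply/ler_addgt0Pl => e e0.
have gx := gauge_ge0 x; have gy := gauge_ge0 y.
(* As [d <= 1], the excess of [(gauge x + d) * (gauge y + d)] over [gauge x * gauge y] is at most
   [d * (gauge x + gauge y + 1)]. *)
pose d := Num.min 1 (e / (gauge x + gauge y + 1)).
have d0 : 0 < d by rewrite lt_min ltr01 divr_gt0 //; lra.
have [a [a0 Va ad]] := gauge_lt (x := x) (r := gauge x + d) ltac:(lra).
have [b [b0 Vb bd]] := gauge_lt (x := y) (r := gauge y + d) ltac:(lra).
have : gauge (x * y) <= v (a * b).
  apply: gauge_le; first by rewrite mulf_neq0.
  by rewrite rmorphM invfM mulrACA; apply: srM.
move=> h; apply: (le_trans h); rewrite (msnM hv).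
have : v a * v b <= (gauge x + d) * (gauge y + d).
  by apply: ler_pM; rewrite ?(msn_ge0 hv) ?ltW.
move=> h2; apply: (le_trans h2).
have d1 : d <= 1 by rewrite ge_min lexx.
have : d * (gauge x + gauge y + 1) <= e.
  by rewrite -ler_pdivlMr ?ge_min ?lexx ?orbT //; lra.
by nra.
Qed.

Lemma gauge1 : gauge 1 = 1.
Proof. by rewrite -(rmorph1 j) gauge_val (msn1 hv). Qed.

(** Density yields [a] with [v a] just below [gauge x]. Then [x / j a] is not in [V], so its inverse
    is, and [gauge x^-1] is at most [(v a)^-1]. *)
Lemma gaugeV_le x : x != 0 -> gauge x * gauge x^-1 <= 1.
Proof.
move=> x0; have gx0 : 0 < gauge x.
  rewrite lt_def gauge_ge0 andbT; apply/eqP => g0.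
  by have := gaugeM_le x x^-1; rewrite mulfV // gauge1 g0 mul0r; lra.
apply: le_limit_scale => // l l1; rewrite mulr1.
have [m [m1 ml]] := exists_root_lower 2 l1.
have r0 : 0 < gauge x / m ^+ 2 by rewrite divr_gt0 ?exprn_gt0 //; lra.
have [a [ra am]] := dv r0 m1.
have agx : v a < gauge x.
  have m0 : 0 < m by lra.
  apply: (le_lt_trans am); have -> : m * (gauge x / m ^+ 2) = gauge x / m.
    by field; rewrite gt_eqF.
  by rewrite ltr_pdivrMr // ltr_pMr.
have a0 : a != 0 by apply/eqP => h; move: ra; rewrite h (msn0 hv); lra.
have Vax : V (x^-1 / j a^-1).
  case: (maximal_dichotomy (x / j a)) => [/(gauge_le a0)|]; first by lra.
  by rewrite invf_div fmorphV invrK mulrC.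
have := gauge_le (invr_neq0 a0) Vax; rewrite (msnV hv) => h.
have va := msn_gt0 hv a0.
have h2 : gauge x <= m ^+ 2 * v a by rewrite -ler_pdivrMl ?exprn_gt0 1?mulrC //; lra.
apply: (@le_trans _ _ (m ^+ 2 * v a / v a)); last by rewrite mulfK ?gt_eqF.
by apply: ler_pM => //; exact: gauge_ge0.
Qed.

Lemma gauge_mulseminorm : mulseminorm gauge.
Proof.
split.
- by rewrite -(rmorph0 j) gauge_val (msn0 hv).
- exact: gauge1.
- exact: gauge_ge0.
- move=> x y; apply/eqP; rewrite eq_le gaugeM_le /=.
  have [->|y0] := eqVneq y 0.
    by rewrite mulr0 -(rmorph0 j) gauge_val (msn0 hv) mulr0.
  have h1 := gaugeM_le (x * y) y^-1; rewrite mulfK // in h1.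
  have h2 := gaugeV_le y0.
  have := gauge_ge0 x; have := gauge_ge0 y; have := gauge_ge0 (x * y).
  have := gauge_ge0 y^-1 => g1 g2 g3 g4.
  apply: (@le_trans _ _ (gauge (x * y) * gauge y^-1 * gauge y)); first by rewrite ler_wpM2r.
  by rewrite -mulrA ler_piMr // mulrC.
- move=> x y; rewrite leNgt; apply/negP; rewrite gt_max => /andP[hx hy].
  have [a [a0 Va ad]] := gauge_lt hx; have [b [b0 Vb bd]] := gauge_lt hy.
  have [ab|/ltW ba] := leP (v a) (v b).
    have := gauge_le b0 (x := x + y); rewrite mulrDl => /(_ _) h.
    have := h (srD sV (lies_over_scale a0 ab Va) Vb); lra.
  have := gauge_le a0 (x := x + y); rewrite mulrDl => /(_ _) h.
  have := h (srD sV Va (lies_over_scale b0 ba Vb)); lra.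
Qed.

End Maximal.

Theorem valuation_extension : dense_values v ->
  (forall x : E, exists p : {poly F}, p != 0 /\ root (map_poly j p) x) ->
  exists v' : E -> R, mulseminorm v' /\ forall a, v' (j a) = v a.
Proof.
move=> dv alg; have [V [oV maxV]] := lies_over_maximal_exists.
exists (gauge V); split; first exact: gauge_mulseminorm.
by move=> a; apply: gauge_val.
Qed.

End ValuationExtension.

(** * Splitting fields carrying an absolute value *)

Lemma irreducible_factor (F : fieldType) (p : {poly F}) : (1 < size p)%N ->
  exists q, irreducible_poly q /\ q %| p.
Proof.
elim: {p}(size p) {-2}p (leqnn (size p)) => [|n IH] p sp p1.
  by move: p1; rewrite ltnNge (leq_trans sp).
have [ip|nip] := pselect (irreducible_poly p); first by exists p; rewrite dvdpp.
have [q [q1 qp npq]] : exists q : {poly F}, [/\ size q != 1%N, q %| p & ~~ (q %= p)].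
  apply: contrapT => no; apply: nip; split => // q q1 qp.
  by apply: contraT => h; exfalso; apply: no; exists q.
have p0 : p != 0 by rewrite -size_poly_gt0 ltnW.
have q0 : q != 0 by apply: contraTneq qp => ->; rewrite dvd0p.
have qlt : (size q < size p)%N.
  by rewrite ltn_neqAle dvdp_leq // andbT; apply: contra npq; rewrite dvdp_size_eqp.
have [||r [ir rq]] := IH q.
- by rewrite -ltnS (leq_trans qlt).
- by rewrite ltn_neqAle eq_sym q1 size_poly_gt0.
by exists r; split => //; apply: dvdp_trans qp.
Qed.

(** One root is adjoined at a time. Each step is a finite extension, so [valuation_extension]
    applies, and density is inherited because the old values persist. *)
Lemma valued_splitting_field (R : realType) (F : fieldType) (v : F -> R) (p : {poly F}) :
  mulseminorm v -> dense_values v -> p != 0 ->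
  exists (E : fieldType) (j : {rmorphism F -> E}) (v' : E -> R) (s : seq E),
    [/\ mulseminorm v', forall a, v' (j a) = v a &
        map_poly j p = j (lead_coef p) *: \prod_(x <- s) ('X - x%:P)].
Proof.
move: {2}(size p) (leqnn (size p)) => n; elim: n F v p => [|n IH] F v p sp hv dv p0.
  by move: sp; rewrite leqn0 size_poly_eq0 (negPf p0).
have [p1|p1] := leqP (size p) 1.
  exists F, idfun, v, [::]; split => //; rewrite big_nil map_poly_id //.
  by rewrite [in LHS](size1_polyC p1) /= lead_coefE (eqP (_ : (size p).-1 == 0%N)) ?alg_polyC //; case: (size p) p1 => [|[]].
have [q [iq qp]] := irreducible_factor p1.
have [L _ [z qz _]] := irredp_FAdjoin iq.
have [|v1 [hv1 v1F]] := @valuation_extension R F L (in_alg L) v hv dv.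
  move=> x; have /polyOver1P[r rE] := minPolyOver 1 x.
  exists r; have := root_minPoly 1 x; rewrite rE => h; split => //.
  by apply/eqP => r0; have := monic_neq0 (monic_minPoly 1 x); rewrite rE r0 rmorph0 eqxx.
have dv1 : dense_values v1.
  by move=> r l r0 l1; have [a ha] := dv r l r0 l1; exists (in_alg L a); rewrite v1F.
have pz : root (map_poly (in_alg L) p) z.
  by move: qz; rewrite -!dvdp_XsubCl => /dvdp_trans; apply; rewrite dvdp_map.
have /factor_theorem[p2 p2E] := pz.
have mp0 : map_poly (in_alg L) p != 0 by rewrite map_poly_eq0.
have p20 : p2 != 0 by apply: contraNneq mp0 => h; rewrite p2E h mul0r.
have sp2 : (size p2 <= n)%N.
  rewrite -ltnS; apply: leq_trans sp.
  by rewrite -(size_map_poly (in_alg L)) p2E size_mul ?polyXsubC_eq0 // size_XsubC addn2.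
have [E [j [v' [s [hv' v'j sE]]]]] := IH L v1 p2 sp2 hv1 dv1 p20.
exists E, (j \o in_alg L), v', (rcons s (j z)); split => //.
  by move=> a; rewrite -v1F -v'j.
have lE : in_alg L (lead_coef p) = lead_coef p2.
  by rewrite -lead_coef_map p2E lead_coefM lead_coefXsubC mulr1.
rewrite -{}lE in sE; rewrite map_poly_comp p2E rmorphM /= sE -scalerAl -cats1 big_cat big_seq1.
by rewrite rmorphB /= map_polyX map_polyC.
Qed.

(** * Approximation by points *)

Section Approximation.
Variables (R : realType) (K : closedFieldType) (w : K -> R).
Hypothesis hw : mulseminorm w.
Hypothesis dw : dense_values w.

(* The seminorm [N] is a limit of seminorms [w \o phi] given by [K]-points [phi] of its support. *)
Definition approximable (B : comNzRingType) (i : K -> B) (N : B -> R) : Prop :=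
  forall (l : R) (Q : seq B), 1 < l -> exists phi : {rmorphism B -> K},
    [/\ cancel i phi, forall b, N b = 0 -> phi b = 0 &
        forall q, q \in Q -> close l (w (phi q)) (N q)].

Lemma approximable_base (B : comNzRingType) (i : K -> B) (N : B -> R) c :
  mulseminorm N -> approximable i N -> N (i c) = w c.
Proof.
move=> hN ap; have wc := msn_ge0 hw c; have Nc := msn_ge0 hN (i c).
apply/eqP; rewrite eq_le; apply/andP; split; apply: le_limit_scale => // l l1;
  have [phi [ic _ cl]] := ap l [:: i c] l1;
  by have [] := cl _ (mem_head _ _); rewrite ic.
Qed.

(** * Approximation after adjoining an algebraic element *)

Section AlgebraicStep.
Variables (B : comNzRingType) (i : K -> B) (N : {poly B} -> R).
Hypothesis hN : mulseminorm N.
Let N0 (b : B) := N b%:P.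
Hypothesis ap : approximable i N0.

Let hN0 : mulseminorm N0.
Proof. exact: (mulseminorm_comp (polyC : {rmorphism B -> {poly B}}) hN). Qed.

(** Vanishing over the residue field of [N0]. The ring [B] is not divided by the support of [N0], so
    relations are handled up to such polynomials. *)
Definition null_poly (p : {poly B}) : Prop := forall k, N0 p`_k = 0.

Lemma msn_eq0_mod p q : N (p - q) = 0 -> N p = N q.
Proof.
have half a b : N (a - b) = 0 -> N a <= N b.
  move=> h; rewrite -(subrK b a); apply: (msnD_le hN) => //.
  by rewrite h; exact: msn_ge0.
by move=> h; apply/eqP; rewrite eq_le !half // (msnBC hN).
Qed.

Lemma msn_add0 p q : N p = 0 -> N q = 0 -> N (p + q) = 0.
Proof.
move=> a b; apply/eqP; rewrite eq_le (msn_ge0 hN) andbT.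
by apply: (msnD_le hN); rewrite ?a ?b.
Qed.

Lemma null_poly_msn p : null_poly p -> N p = 0.
Proof.
move=> h; apply/eqP; rewrite eq_le (msn_ge0 hN) andbT -[p]coefK poly_def.
apply: (msn_sum hN) => // k _; rewrite -mul_polyC (msnM hN).
by rewrite -[N _%:P]/(N0 _) h mul0r.
Qed.

(** Over the residue field of [N0], [p0] becomes a minimal polynomial of the class of ['X]. Were its
    leading coefficient in the support, truncation would give a shorter relation. *)
Lemma minimal_relation : (exists p, N p = 0 /\ ~ null_poly p) ->
  exists p0, [/\ N p0 = 0, N0 (lead_coef p0) <> 0, (1 < size p0)%N &
    forall p, N p = 0 -> (size p < size p0)%N -> null_poly p].
Proof.
move=> [p [Np pn]].
have ex : exists n, `[< exists p, [/\ N p = 0, ~ null_poly p & size p = n] >].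
  by exists (size p); apply/asboolP; exists p.
case: (ex_minnP ex) => n /asboolP[p0 [Np0 p0n sp0]] minn.
have min q : N q = 0 -> (size q < size p0)%N -> null_poly q.
  move=> Nq; rewrite sp0 => sq; apply: contrapT => nq.
  have /minn : `[< exists p, [/\ N p = 0, ~ null_poly p & size p = size q] >].
    by apply/asboolP; exists q.
  by rewrite leqNgt sq.
have p00 : p0 != 0.
  by apply/eqP => h; apply: p0n => k; rewrite h coef0 (msn0 hN0).
have lead : N0 (lead_coef p0) <> 0.
  move=> l0; apply: p0n; pose q := take_poly (size p0).-1 p0.
  have dn : null_poly (p0 - q).
    move=> k; rewrite coefB coef_take_poly; case: ltnP => [_|].
      by rewrite subrr (msn0 hN0).
    rewrite subr0 leq_eqVlt => /orP[/eqP<-|]; first by rewrite -lead_coefE.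
    by rewrite prednK ?size_poly_gt0 // => h; rewrite nth_default ?(msn0 hN0).
  have qn : null_poly q.
    apply: min; first by rewrite -(msn_eq0_mod (null_poly_msn dn)).
    apply: leq_ltn_trans (size_take_poly _ _) _.
    by rewrite ltn_predL size_poly_gt0.
  move=> k; have := dn k; rewrite coefB => h.
  apply/eqP; rewrite eq_le (msn_ge0 hN0) andbT -(subrK q`_k p0`_k).
  by apply: (msnD_le hN0); rewrite ?h ?qn.
exists p0; split => //; rewrite ltnNge; apply/negP => s1; apply: lead.
by rewrite (size1_polyC s1) lead_coefC /N0 -size1_polyC.
Qed.

Section Relation.
Variable p0 : {poly B}.
Hypothesis Np0 : N p0 = 0.
Hypothesis lead0 : N0 (lead_coef p0) <> 0.
Hypothesis size_p0 : (1 < size p0)%N.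
Hypothesis minp0 : forall p, N p = 0 -> (size p < size p0)%N -> null_poly p.

Let p0_neq0 : p0 != 0.
Proof. by rewrite -size_poly_gt0 ltnW. Qed.

Section Point.
Variable phi : {rmorphism B -> K}.
Hypothesis kphi : forall b, N0 b = 0 -> phi b = 0.
Hypothesis lphi : phi (lead_coef p0) != 0.

Definition eval_at (t : K) : {poly B} -> K := horner_eval t \o map_poly phi.

(** Pseudo-division by [p0] leaves a remainder that is null by minimality, hence killed by [phi].
    The power of the leading coefficient is then cancelled. *)
Lemma eval_at_kernel t p : root (map_poly phi p0) t -> N p = 0 -> eval_at t p = 0.
Proof.
move=> /rootP rt Np.
have E := Pdiv.ComRing.rdivp_eq p0 p.
have rn : null_poly (Pdiv.Ring.rmodp p p0).
  apply: minp0; last by rewrite Pdiv.Ring.ltn_rmodp.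
  have -> : Pdiv.Ring.rmodp p p0 = lead_coef p0 ^+ Pdiv.Ring.rscalp p p0 *: p
      + - Pdiv.Ring.rdivp p p0 * p0 by rewrite E mulNr addrAC subrr add0r.
  by apply: msn_add0; rewrite -?mul_polyC (msnM hN) ?Np ?Np0 mulr0.
have /(congr1 (eval_at t)) := E.
rewrite /eval_at /= -mul_polyC rmorphD !rmorphM /= /horner_eval !hornerE map_polyC hornerC /= rt mulr0 add0r.
have -> : map_poly phi (Pdiv.Ring.rmodp p p0) = 0.
  by apply/polyP => k; rewrite coef_map coef0; exact: kphi.
rewrite horner0 rmorphXn => /eqP; rewrite mulf_eq0 expf_eq0 (negPf lphi) andbF /=.
by move/eqP.
Qed.

End Point.

(* [shift h] agrees with [h] at the roots of [p0], and its leading coefficient is that of [p0]. *)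
Definition shift (h : {poly B}) : {poly B} := h + p0 * 'X^(size h).

Lemma size_shift h : size (shift h) = (size p0 + size h)%N.
Proof.
have sX : size (p0 * 'X^(size h)) = (size p0 + size h)%N by rewrite size_mulXn // addnC.
by rewrite /shift addrC size_polyDl sX // -[ltnLHS]add0n ltn_add2r ltnW.
Qed.

Lemma lead_coef_shift h : lead_coef (shift h) = lead_coef p0.
Proof.
rewrite /shift addrC lead_coefDl ?lead_coef_Mmonic ?monicXn //.
by rewrite size_mulXn // -[ltnLHS]addn0 ltn_add2l ltnW.
Qed.

Lemma msn_shift_sub h : N (shift h - h) = 0.
Proof. by rewrite /shift addrAC subrr add0r (msnM hN) Np0 mul0r. Qed.

Lemma msn_shift h : N (shift h) = N h.
Proof. exact/msn_eq0_mod/msn_shift_sub. Qed.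

(* Up to a power of the leading coefficient, [\prod_t ('X - h(t))] over the roots [t] of [p0]. *)
Definition char_elim (h : {poly B}) : {poly B} :=
  resultant (map_poly polyC p0) ('X%:P - map_poly polyC (shift h)).

Let size_second h : size ('X%:P - map_poly polyC (shift h) : {poly {poly B}}) = (size p0 + size h)%N.
Proof.
rewrite addrC size_polyDl size_polyN size_map_polyC size_shift //.
by apply: leq_ltn_trans (size_polyC_leq1 _) _; rewrite ltn_addr.
Qed.

Let lead_second h :
  lead_coef ('X%:P - map_poly polyC (shift h) : {poly {poly B}}) = - (lead_coef p0)%:P.
Proof.
rewrite addrC lead_coefDl ?size_polyN ?size_map_polyC ?size_shift; last first.
  by apply: leq_ltn_trans (size_polyC_leq1 _) _; rewrite ltn_addr.
by rewrite lead_coefN lead_coef_map_inj ?lead_coef_shift //; exact: polyC_inj.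
Qed.

(** A Cayley-Hamilton identity: the resultant is a combination of its two arguments. Substituting
    [shift h] for the inner variable and ['X] for the outer one kills the second argument and turns
    the first into [p0]. *)
Lemma char_elim_comp h : N (char_elim h \Po shift h) = 0.
Proof.
have [||[u v] _ E] := @resultant_in_ideal _ (map_poly polyC p0)
    ('X%:P - map_poly polyC (shift h)); rewrite ?size_map_polyC //.
  by rewrite size_second ltn_addr.
rewrite -/(char_elim h) /= in E.
have := congr1 (fun P => (map_poly (comp_poly (shift h)) P).['X]) E.
have pc q : (map_poly (comp_poly (shift h)) (map_poly polyC q)).['X] = q.
  rewrite -map_poly_comp -[RHS]comp_polyXr; congr (_.[_]); apply: eq_map_poly => c /=.
  exact: comp_polyC.
rewrite rmorphD !rmorphM rmorphB /= !map_polyC !hornerE /= pc pc comp_polyX subrr mulr0 addr0.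
by move=> ->; rewrite (msnM hN) Np0 mulr0.
Qed.

(** Both leading coefficients survive [phi], thanks to [shift], so the resultant commutes with
    specialization and vanishes exactly when the specialized polynomials share a root. *)
Lemma root_char_elim (phi : {rmorphism B -> K}) h x : phi (lead_coef p0) != 0 ->
  root (map_poly phi (char_elim h)) x <->
  exists t, root (map_poly phi p0) t /\ eval_at phi t h = x.
Proof.
move=> lphi; pose g : {rmorphism {poly B} -> K} := horner_eval x \o map_poly phi.
have gC c : g c%:P = phi c by rewrite /g /= /horner_eval map_polyC hornerC.
have mg q : map_poly g (map_poly polyC q) = map_poly phi q.
  by rewrite -map_poly_comp; apply: eq_map_poly => c; exact: gC.
have mp0 : map_poly phi p0 != 0.
  by rewrite -lead_coef_eq0 lead_coef_map_eq.
rewrite /root -[_.[_]]/(g (char_elim h)) /char_elim map_resultant; first last.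
- by rewrite lead_second rmorphN oppr_eq0 gC.
- by rewrite lead_coef_map_inj ?gC //; exact: polyC_inj.
rewrite rmorphB /= map_polyC /= mg mg.
rewrite /= /horner_eval map_polyX hornerX.
have ev t : root (map_poly phi p0) t ->
    root (x%:P - map_poly phi (shift h)) t = (eval_at phi t h == x).
  move=> /rootP rt; rewrite /root !hornerE rmorphD rmorphM /= !hornerE rt mul0r addr0.
  by rewrite subr_eq0 eq_sym.
rewrite resultant_eq0; split => [h1|[t [rt /eqP tx]]].
  have /closed_rootP[t] : size (gcdp (map_poly phi p0) (x%:P - map_poly phi (shift h))) != 1%N.
    by rewrite neq_ltn h1 orbT.
  by rewrite root_gcd => /andP[rt]; rewrite ev // => /eqP tx; exists t.
apply: (@root_size_gt1 _ t); last by rewrite root_gcd ev // tx andbT; exact: rt.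
by rewrite gcdp_eq0 negb_and mp0.
Qed.

(** If [h] were larger than [m] at all roots, [coef_root_bound] would make the constant coefficient
    of [char_elim h] strictly dominant for [N0]. As [N h <= 1], it would also dominate in the
    identity [char_elim_comp], which has value [0]. *)
Lemma small_root (phi : {rmorphism B -> K}) h l m : 1 < l -> l * l < m ->
  (forall b, N0 b = 0 -> phi b = 0) -> phi (lead_coef p0) != 0 -> N h <= 1 ->
  (forall k, close l (w (phi (char_elim h)`_k)) (N0 (char_elim h)`_k)) ->
  exists t, root (map_poly phi p0) t /\ w (eval_at phi t h) <= m.
Proof.
move=> l1 lm kphi lphi Nh cl; apply: contrapT => no.
have m1 : 1 < m by nra.
have big x : root (map_poly phi (char_elim h)) x -> m < w x.
  move=> /root_char_elim-/(_ lphi)[t [rt <-]].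
  by rewrite ltNge; apply/negP => tm; apply: no; exists t.
set c := char_elim h in cl big *.
have cpos k : w (phi c`_k) * m ^+ k <= w (phi c`_0).
  rewrite -!coef_map; apply: (coef_root_bound hw); first by lra.
  by move=> x /big/ltW.
have c0 : N0 c`_0 <> 0.
  move=> /kphi z; have /big : root (map_poly phi c) 0.
    by apply/rootP; rewrite horner_coef0 coef_map.
  by rewrite (msn0 hw); lra.
have c0' : 0 < N0 c`_0 by rewrite lt_def (msn_ge0 hN0) andbT; apply/eqP.
(* Passing from [w \o phi] to [N0] costs a factor [l] on each side; a single factor [m > l * l] from
   the root bound pays for both. *)
have dom k : N0 c`_k.+1 < N0 c`_0.
  have := cpos k.+1; rewrite exprS mulrCA => h1.
  have [h2 h3] := cl k.+1; have [h4 h5] := cl 0%N.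
  have mk : 1 <= m ^+ k by rewrite exprn_ege1 // ltW.
  have x0 := msn_ge0 hw (phi c`_k.+1).
  have h6 : w (phi c`_k.+1) <= w (phi c`_k.+1) * m ^+ k by rewrite ler_peMr.
  have h7 : m * w (phi c`_k.+1) <= w (phi c`_0) by nra.
  have h8 : m * w (phi c`_k.+1) <= l * N0 c`_0 by lra.
  have h9 : m * N0 c`_k.+1 <= l * (l * N0 c`_0) by nra.
  have : l * (l * N0 c`_0) < m * N0 c`_0 by rewrite mulrA ltr_pM2r.
  by move=> h10; have := le_lt_trans h9 h10; rewrite ltr_pM2l //; lra.
have := char_elim_comp h; rewrite -/c comp_polyE.
case sc: (size c) => [|n]; first by move: c0; rewrite nth_default ?sc // (msn0 hN0).
rewrite big_ord_recl expr0 alg_polyC addrC (msnD_eqr hN) //.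
apply: (msn_sum_lt hN) => // k _; rewrite -mul_polyC (msnM hN) (msnX hN) msn_shift.
apply: le_lt_trans (dom k); rewrite /bump /= ler_piMr ?(msn_ge0 hN) //.
by rewrite exprn_ile1 ?(msn_ge0 hN).
Qed.

Lemma pigeonhole_count (S T : eqType) (s : seq S) (t : seq T) (g : T -> pred S) n :
  (forall x, x \in s -> exists2 y, y \in t & g y x) -> (size t * n < size s)%N ->
  exists2 y, y \in t & (n < count (g y) s)%N.
Proof.
move=> cov lt; apply: contrapT => no.
have : (size s <= \sum_(y <- t) count (g y) s)%N.
  elim: s cov {lt no} => [|x s IH] cov; first by rewrite big1.
  rewrite /= big_split /= -add1n leq_add ?IH //; last first.
    by move=> z zs; apply: cov; rewrite inE zs orbT.
  have [y yt gyx] := cov x (mem_head _ _).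
  by rewrite (perm_big _ (perm_to_rem yt)) big_cons gyx.
rewrite leqNgt => /negP; apply; apply: leq_ltn_trans lt.
rewrite -sum1_size big_distrl /= big_seq [leqRHS]big_seq; apply: leq_sum => y yt.
by rewrite mul1n leqNgt; apply/negP => h; apply: no; exists y.
Qed.

(* The multipliers [z] are units with unit differences: a root good for more than [size qs]
   of the combinations [\sum_k z ^+ k * qs`_k] is good for each term of [qs]. *)
Lemma simultaneous_bound_unit m (qs : seq {poly B}) (Q1 : seq B) : 1 < m ->
  (forall q, q \in qs -> N q <= 1) ->
  exists (phi : {rmorphism B -> K}) (t : K),
    [/\ cancel i phi, forall b, N0 b = 0 -> phi b = 0, phi (lead_coef p0) != 0,
        forall q, q \in Q1 -> close m (w (phi q)) (N0 q) &
        root (map_poly phi p0) t /\ forall q, q \in qs -> w (eval_at phi t q) <= m].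
Proof.
move=> m1 Nqs; have [l [l1 l3]] := exists_root_lower 3 m1.
have lm : l * l < m.
  apply: lt_le_trans l3; rewrite !exprS expr0 mulr1.
  by rewrite ltr_pMl // mulr_gt0 //; lra.
have l_m : l <= m by nra.
(* There are at most [size p0] roots, so with this many multipliers some root serves more than
   [size qs] of them. *)
have [Z [sZ Z1 Zp]] := separated_units hw (size p0 * size qs).+1.
pose comb (z : K) := \sum_(k < size qs) (i (z ^+ k))%:P * qs`_k.
have Ncomb z : z \in Z -> N (comb z) <= 1.
  move=> zZ; apply: (msn_sum hN) => // k _; rewrite (msnM hN) mulr_ile1 ?(msn_ge0 hN) //.
    by rewrite -[N _%:P]/(N0 _) (approximable_base _ hN0 ap) (msnX hw) exprn_ile1 ?(msn_ge0 hw) // Z1.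
  by apply: Nqs; apply: mem_nth.
(* Closeness at the leading coefficient makes its image nonzero; the coefficients of each
   [char_elim (comb z)] are those needed by [small_root]. *)
have [phi [ic kphi cl]] :=
  ap (lead_coef p0 :: Q1 ++ flatten [seq (char_elim (comb z) : seq B) | z <- Z]) l1.
have lphi : phi (lead_coef p0) != 0.
  apply/eqP => h; have [_] := cl _ (mem_head _ _).
  rewrite h (msn0 hw) mulr0 => h1; apply: lead0; apply/eqP.
  by rewrite eq_le h1 (msn_ge0 hN0).
pose rs := sval (closed_field_poly_normal (map_poly phi p0)).
have rsE := svalP (closed_field_poly_normal (map_poly phi p0)); rewrite -/rs in rsE.
have mp0 : map_poly phi p0 != 0 by rewrite -lead_coef_eq0 lead_coef_map_eq.
have rsP t : root (map_poly phi p0) t = (t \in rs).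
  by rewrite rsE rootZ ?lead_coef_eq0 // root_prod_XsubC.
have srs : (size rs <= size p0)%N.
  have := size_poly (size p0) (fun k => phi p0`_k); rewrite -/(map_poly phi p0) rsE.
  by rewrite size_scale ?lead_coef_eq0 // size_prod_XsubC => /ltnW.
(* The values at [t] of the terms of [qs] are the coefficients of [x t], those of the combinations
   are its values at the points [z]; [interpolation_bound] leads from the latter to the former. *)
pose x (t : K) := \poly_(k < size qs) eval_at phi t qs`_k.
have combE t z : eval_at phi t (comb z) = (x t).[z].
  rewrite horner_poly /eval_at /= rmorph_sum /horner_eval horner_sum.
  apply: eq_bigr => k _; rewrite rmorphM hornerM /= map_polyC hornerC /= ic.
  by rewrite mulrC.
have [||t trs cnt] := @pigeonhole_count _ _ Z rs (fun t z => w (eval_at phi t (comb z)) <= m) (size qs).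
- move=> z zZ; have [||t [rt tm]] := @small_root phi (comb z) l m l1 lm kphi lphi.
  + exact: Ncomb.
  + move=> k; have [sk|sk] := ltnP k (size (char_elim (comb z))); last first.
      by rewrite nth_default // rmorph0 (msn0 hw) (msn0 hN0) /close mulr0.
    apply: cl; rewrite inE mem_cat; apply/orP; right; apply/orP; right.
    apply/flattenP; exists (char_elim (comb z) : seq B); last exact: mem_nth.
    by apply/mapP; exists z.
  by exists t; rewrite -?rsP.
- by rewrite sZ ltnS leq_mul2r srs orbT.
exists phi, t; split => //.
  move=> q qQ; apply: (close_weaken l_m); rewrite ?(msn_ge0 hw) ?(msn_ge0 hN0) //.
  by apply: cl; rewrite inE mem_cat qQ orbT.
split; first by rewrite rsP.
move=> q qqs; pose s := [seq z <- Z | w (eval_at phi t (comb z)) <= m].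
have : w (x t)`_(index q qs) <= m.
  apply: (@interpolation_bound _ _ w s) => //; first by lra.
  - by move=> z; rewrite mem_filter => /andP[_ /Z1].
  - exact: pairwise_filter.
  - by apply: leq_trans (size_poly _ _) _; rewrite size_filter ltnW.
  - by move=> z; rewrite mem_filter combE => /andP[].
by rewrite coef_poly index_mem qqs nth_index.
Qed.

(** By density each [q] with [N q] nonzero is scaled by a constant to norm between [l^-1] and [1],
    which reduces to the unit case. The remaining [q] vanish at [t] by [eval_at_kernel]. *)
Lemma simultaneous_bound m (qs : seq {poly B}) (Q1 : seq B) : 1 < m ->
  exists (phi : {rmorphism B -> K}) (t : K),
    [/\ cancel i phi, forall b, N0 b = 0 -> phi b = 0, phi (lead_coef p0) != 0,
        forall q, q \in Q1 -> close m (w (phi q)) (N0 q) &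
        root (map_poly phi p0) t /\ forall q, q \in qs -> w (eval_at phi t q) <= m * N q].
Proof.
move=> m1; have [l [l1 l2]] := exists_root_lower 2 m1.
have /boolp.choice[kap hkap] : forall q, exists c : K,
    N q <> 0 -> 1 <= l * (w c * N q) /\ w c * N q <= 1.
  move=> q; have [->|q0] := eqVneq (N q) 0; first by exists 0.
  have q0' : 0 < N q by rewrite lt_def q0 (msn_ge0 hN).
  have [|c [c1 c2]] := dw (r := (l * N q)^-1) _ l1; first by rewrite invr_gt0 mulr_gt0 //; lra.
  exists c => _; split.
    have lq : 0 < l * N q by rewrite mulr_gt0 //; lra.
    by rewrite mulrCA -[X in X <= _](mulVf (lt0r_neq0 lq)) ler_pM2r.
  rewrite -ler_pdivlMr // div1r; apply: (le_trans c2).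
  by rewrite invfM mulrA divff ?mul1r // gt_eqF //; lra.
pose sc q := (i (kap q))%:P * q.
have Nsc q : N (sc q) = w (kap q) * N q.
  by rewrite (msnM hN) -[N _%:P]/(N0 _) (approximable_base _ hN0 ap).
have [|phi [t [ic kphi lphi cl [rt ht]]]] :=
  @simultaneous_bound_unit l [seq sc q | q <- qs & N q != 0] Q1 l1.
  by move=> _ /mapP[q + ->]; rewrite mem_filter Nsc => /andP[/eqP/hkap[]].
exists phi, t; split => //.
  by move=> q qQ; apply: (close_weaken _ _ _ (cl q qQ)); rewrite ?(msn_ge0 hw) ?(msn_ge0 hN0) //; nra.
split => // q qqs; have [q0|q0] := eqVneq (N q) 0.
  by rewrite (eval_at_kernel kphi lphi rt q0) (msn0 hw) q0 mulr0.
have := ht (sc q); rewrite map_f ?mem_filter ?q0 // => /(_ isT).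
have -> : eval_at phi t (sc q) = kap q * eval_at phi t q.
  by rewrite /eval_at /= /horner_eval rmorphM hornerM /= map_polyC hornerC /= ic.
rewrite (msnM hw); have [k1 k2] := hkap q (elimN eqP q0).
have := msn_ge0 hw (kap q); have := msn_ge0 hN q; have := msn_ge0 hw (eval_at phi t q).
move: (w (kap q)) (N q) (w (eval_at phi t q)) k1 k2 q0 => k n x k1 k2 n0 x0 nn0 k0 kx.
have kp : 0 < k by rewrite lt_def k0 andbT; apply/eqP => h; rewrite h in k1; lra.
have : k * x <= k * (l ^+ 2 * n).
  apply: (le_trans kx); rewrite mulrCA -[leLHS]mulr1 expr2 -mulrA.
  by rewrite ler_pM2l //; lra.
rewrite ler_pM2l // => h; apply: (le_trans h); by rewrite ler_wpM2r.
Qed.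

(** With [c]_k[the first coefficient of]char_elim
    q[outside the support, the identity]char_elim_comp[may be divided by]q ^+
    k[; it then expresses]c[_k] as a multiple of [q] modulo the kernel of [N]. *)
Lemma quasi_inverse q : N q <> 0 ->
  exists r d, N0 d <> 0 /\ N (r * q - d%:P) = 0.
Proof.
move=> Nq; have [phi [ic kphi cl]] := ap [:: lead_coef p0] (ltr1n R 2).
have lphi : phi (lead_coef p0) != 0.
  apply/eqP => h; have [_] := cl _ (mem_head _ _).
  rewrite h (msn0 hw) mulr0 => h1; apply: lead0; apply/eqP.
  by rewrite eq_le h1 (msn_ge0 hN0).
set c := char_elim q; set H := shift q.
(* The roots of the specialized [c] are values of [q] at the finitely many roots of the specialized
   [p0], so some [x] in [K] is not one of them and that polynomial is nonzero. *)
have ex : exists k, N0 c`_k != 0.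
  have [rs rsE] := closed_field_poly_normal (map_poly phi p0).
  have mp0 : map_poly phi p0 != 0 by rewrite -lead_coef_eq0 lead_coef_map_eq.
  have /closed_nonrootP[x xP] : \prod_(t <- rs) ('X - (eval_at phi t q)%:P) != 0.
    exact/monic_neq0/monic_prod_XsubC.
  apply: contrapT => no.
  have : root (map_poly phi c) x.
    suff -> : map_poly phi c = 0 by exact: root0.
    apply/polyP => k; rewrite coef_map coef0; apply: kphi.
    by apply/eqP; apply: contrapT => /negP h; apply: no; exists k.
  move=> /root_char_elim-/(_ lphi)[t [rt tx]]; move/negP: xP; apply.
  rewrite -(big_map (fun t => eval_at phi t q) xpredT (fun y => 'X - y%:P)) root_prod_XsubC.
  apply/mapP; exists t => //.
  by move: rt; rewrite rsE rootZ ?lead_coef_eq0 // root_prod_XsubC.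
case: (ex_minnP ex) => k /eqP ck kmin.
have comp_polyXn n : 'X^n \Po H = H ^+ n by rewrite rmorphXn /= comp_polyX.
pose D := drop_poly k c; pose D' := drop_poly 1 D.
have ND : N (D \Po H) = 0.
  have : N ((D \Po H) * H ^+ k) = 0.
    have := char_elim_comp q; rewrite -/c -/H -{1}(poly_take_drop k c).
    rewrite comp_polyD comp_polyM comp_polyXn => h.
    rewrite -(msn_eq0_mod (p := take_poly k c \Po H + (D \Po H) * H ^+ k)) // addrK.
    rewrite comp_polyE; apply/eqP; rewrite eq_le (msn_ge0 hN) andbT.
    apply: (msn_sum hN) => // j _; rewrite -mul_polyC (msnM hN) coef_take_poly.
    case: ltnP => [jk|_]; last by rewrite (msn0 hN) mul0r.
    suff -> : N (c`_j)%:P = 0 by rewrite mul0r.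
    by apply/eqP; apply: contraTT jk => /kmin; rewrite -leqNgt.
  rewrite (msnM hN) (msnX hN) msn_shift => /eqP.
  by rewrite mulf_eq0 expf_eq0 => /orP[/eqP//|/andP[_ /eqP]].
exists (- (D' \Po H)), c`_k; split => //.
have DE : D \Po H = (c`_k)%:P + (D' \Po H) * H.
  rewrite -{1}(poly_take_drop 1 D) comp_polyD comp_polyM comp_polyXn expr1; congr (_ + _).
  have -> : take_poly 1 D = (c`_k)%:P.
    by apply/polyP => j; rewrite coef_take_poly coefC /D coef_drop_poly; case: j.
  exact: comp_polyC.
have -> : - (D' \Po H) * q - (c`_k)%:P = - (D \Po H) + (D' \Po H) * (H - q).
  by rewrite DE; ring.
by apply: msn_add0; rewrite ?(msnN hN) // (msnM hN) msn_shift_sub mulr0.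
Qed.

(** Upper bounds come from [simultaneous_bound]. The lower bound for [q] follows from the upper
    bound for its quasi-inverse [r], since [r * q] equals an element [d] of [B] that is approximated
    already. *)
Lemma approximable_relation : approximable (polyC \o i) N.
Proof.
move=> l Q l1; have [m [m1 m2]] := exists_root_lower 2 l1.
have /boolp.choice[inv hinv] : forall q, exists rd : {poly B} * B, N q <> 0 ->
    N0 rd.2 <> 0 /\ N (rd.1 * q - rd.2%:P) = 0.
  move=> q; have [->|/eqP/quasi_inverse[r [d h]]] := eqVneq (N q) 0.
    by exists (0, 0).
  by exists (r, d).
have [phi [t [ic kphi lphi cl [rt ht]]]] :=
  simultaneous_bound (Q ++ [seq (inv q).1 | q <- Q]) [seq (inv q).2 | q <- Q] m1.
exists (horner_eval t \o map_poly phi); split.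
- by move=> c; rewrite /= /horner_eval map_polyC hornerC /= ic.
- by move=> p Np; apply: (eval_at_kernel kphi lphi rt Np).
move=> q qQ; rewrite -[X in close _ (w X)]/(eval_at phi t q).
have w0 x := msn_ge0 hw x; have n0 x := msn_ge0 hN x.
have hi : w (eval_at phi t q) <= m * N q by apply: ht; rewrite mem_cat qQ.
have mm : m * m <= l by rewrite -expr2.
split.
  apply: (le_trans hi); rewrite ler_wpM2r //; nra.
have [->|/eqP Nq] := eqVneq (N q) 0; first by rewrite mulr_ge0 //; lra.
have [] := hinv q Nq; case E: (inv q) => [r d] /= d0 rd.
have hr : w (eval_at phi t r) <= m * N r.
  by apply: ht; rewrite mem_cat; apply/orP; right; apply/mapP; exists q; rewrite ?E.
have [_ hd] : close m (w (phi d)) (N0 d) by apply: cl; apply/mapP; exists q; rewrite ?E.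
have Nd : N r * N q = N0 d by rewrite -(msnM hN); exact: msn_eq0_mod.
have wd : w (eval_at phi t r) * w (eval_at phi t q) = w (phi d).
  rewrite -(msnM hw); congr w; have := eval_at_kernel kphi lphi rt rd.
  rewrite /eval_at /= rmorphB rmorphM /= /horner_eval !hornerE map_polyC hornerC /=.
  by move/eqP; rewrite subr_eq0 => /eqP.
have r0 : 0 < N r.
  by rewrite lt_def n0 andbT; apply/eqP => h; apply: d0; rewrite -Nd h mul0r.
rewrite -(ler_pM2l r0) Nd; apply: (le_trans hd); rewrite -wd.
have : m * (w (eval_at phi t r) * w (eval_at phi t q)) <= m * ((m * N r) * w (eval_at phi t q)).
  by rewrite ler_pM2l ?ler_wpM2r //; lra.
move=> h; apply: (le_trans h).
have -> : m * (m * N r * w (eval_at phi t q)) = N r * (m * m * w (eval_at phi t q)) by ring.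
by rewrite ler_pM2l // ler_wpM2r.
Qed.

End Relation.

Lemma approximable_algebraic :
  (exists p, N p = 0 /\ ~ null_poly p) -> approximable (polyC \o i) N.
Proof. by move=> /minimal_relation[p0 []]; exact: approximable_relation. Qed.

End AlgebraicStep.
End Approximation.

(** * Towers of adjunctions and the transcendental case *)

Section Tower.
Variables (R : realType) (K : closedFieldType) (w : K -> R).
Hypothesis hw : mulseminorm w.
Hypothesis dw : dense_values w.

Section Adjunction.
Variables (L : fieldType) (v : L -> R).
Hypothesis hv : mulseminorm v.

Lemma approximable_poly_algebraic (B : comNzRingType) (i : K -> B) (u : {rmorphism B -> L}) t :
  (exists p : {poly B}, map_poly u p != 0 /\ root (map_poly u p) t) ->
  approximable w i (v \o u) ->
  approximable w (polyC \o i) (v \o (horner_eval t \o map_poly u)).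
Proof.
move=> [p [p0 /rootP pt]] ap.
have EC : (fun b : B => (v \o (horner_eval t \o map_poly u)) b%:P) = v \o u.
  by apply/funext => b; rewrite /= /horner_eval map_polyC hornerC.
apply: approximable_algebraic => //; rewrite ?EC //.
  exact: (mulseminorm_comp (horner_eval t \o map_poly u : {rmorphism {poly B} -> L}) hv).
exists p; split; first by rewrite /= /horner_eval pt (msn0 hv).
move=> np; move/eqP: p0; apply; apply/polyP => k; rewrite coef_map coef0 /=.
have := np k; rewrite /= /horner_eval map_polyC hornerC => /eqP.
by rewrite (msn_eq0 hv) => /eqP.
Qed.

(** The step is assumed over every ring [C] above [B], because each adjunction replaces the base
    ring by a polynomial ring. *)
Lemma adjoin_family (B : comNzRingType) (i : K -> B) (u : {rmorphism B -> L}) (s : seq L) :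
  (forall (C : comNzRingType) (k : K -> C) (e : {rmorphism B -> C}) (u' : {rmorphism C -> L}) t,
    t \in s -> (forall b, u' (e b) = u b) -> approximable w k (v \o u') ->
    approximable w (polyC \o k) (v \o (horner_eval t \o map_poly u'))) ->
  approximable w i (v \o u) ->
  exists (C : comNzRingType) (e : {rmorphism B -> C}) (u' : {rmorphism C -> L}),
    [/\ forall b, u' (e b) = u b, approximable w (e \o i) (v \o u') &
        forall t, t \in s -> exists y, u' y = t].
Proof.
elim: s B i u => [|t s IH] B i u step ap; first by exists B, idfun, u.
pose u1 : {rmorphism {poly B} -> L} := horner_eval t \o map_poly u.
have u1C b : u1 b%:P = u b by rewrite /u1 /= /horner_eval map_polyC hornerC.
have [||C [e [u' [ue ap' hs]]]] := IH {poly B} (polyC \o i) u1.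
- move=> C k e u' t' t's ue; apply: (step C k (e \o polyC)).
    by rewrite inE t's orbT.
  by move=> b /=; rewrite ue.
- by apply: (step B i idfun u t) => //; exact: mem_head.
exists C, (e \o polyC), u'; split => //.
  by move=> b /=; rewrite ue.
move=> t'; rewrite inE => /orP[/eqP->|/hs //].
by exists (e 'X); rewrite ue /u1 /= /horner_eval map_polyX hornerX.
Qed.

Lemma nearest_exists (f : L -> R) (s : seq L) : s != [::] ->
  exists2 x, x \in s & forall y, y \in s -> f x <= f y.
Proof.
elim: s => // x [_ _|y s IH _]; first by exists x; rewrite ?mem_head // => y; rewrite inE => /eqP->.
have [z zs zmin] := IH isT; have [xz|/ltW zx] := leP (f x) (f z).
  exists x; rewrite ?mem_head // => t; rewrite inE => /orP[/eqP->//|/zmin].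
  exact: le_trans.
exists z; first by rewrite inE zs orbT.
by move=> t; rewrite inE => /orP[/eqP->|/zmin].
Qed.

(** With [x0] nearest to [t], the distance from [t] to [x] is the maximum of those from [x0] to [t]
    and to [x]. A generic point at about the first distance from [y x0] has the same property with
    respect to the [y x]. *)
Lemma position_transfer (s : seq L) (t : L) (y : L -> K) l : 1 < l -> t \notin s ->
  (forall x x', x \in s -> x' \in s -> close l (w (y x - y x')) (v (x - x'))) ->
  exists c, forall x, x \in s -> close l (w (c - y x)) (v (t - x)).
Proof.
move=> l1 ts cl; have [->|s0] := eqVneq s [::]; first by exists 0.
have [x0 x0s x0min] := nearest_exists (fun x => v (t - x)) s0.
have r0 : 0 < v (t - x0).
  by apply: (msn_gt0 hv); rewrite subr_eq0; apply: contraNneq ts => ->.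
have [a [a1 a2]] := dw r0 l1.
have a0 : a != 0 by apply/eqP => h; move: a1; rewrite h (msn0 hw); lra.
have [b [ba hb]] := generic_element hw [seq y x - y x0 | x <- s] a0.
exists (y x0 + b) => x xs.
have -> : y x0 + b - y x = b - (y x - y x0) by ring.
have /hb hbx : y x - y x0 \in [seq y x - y x0 | x <- s] by apply/mapP; exists x.
have -> : w (b - (y x - y x0)) = Num.max (w a) (w (y x - y x0)).
  apply/eqP; rewrite eq_le; apply/andP; split.
    by apply: (msnB_le hw); rewrite le_max ?ba ?lexx ?orbT.
  rewrite ge_max hbx /=; have [h|h] := leP (w (y x - y x0)) (w a).
    exact: (le_trans h).
  by rewrite [leRHS](msnD_eqr hw) (msnN hw) ?lexx // (le_lt_trans ba).
have -> : v (t - x) = Num.max (v (t - x0)) (v (x - x0)).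
  have E : x - x0 = (t - x0) - (t - x) by ring.
  apply/eqP; rewrite eq_le; apply/andP; split.
    have -> : t - x = (t - x0) - (x - x0) by ring.
    by apply: (msnB_le hv); rewrite le_max lexx ?orbT.
  by rewrite ge_max x0min //= E (msnB_le hv) // x0min.
apply: close_max; [by lra| |exact: cl].
by split => //; nra.
Qed.

End Adjunction.

Lemma close_prod (I : eqType) (r : seq I) (f g : I -> R) l : 1 <= l ->
  (forall x, 0 <= f x) -> (forall x, 0 <= g x) ->
  (forall x, x \in r -> close l (f x) (g x)) ->
  close (l ^+ size r) (\prod_(x <- r) f x) (\prod_(x <- r) g x).
Proof.
move=> l1 f0 g0; elim: r => [|x r IH] h.
  by rewrite !big_nil expr0; apply: close_refl.
rewrite !big_cons exprS; apply: close_mul => //; rewrite ?exprn_ge0 ?prodr_ge0 //; try lra.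
  by apply: h; exact: mem_head.
by apply: IH => z zr; apply: h; rewrite inE zr orbT.
Qed.

Lemma approximable_poly (L : fieldType) (v : L -> R) (B : comNzRingType)
    (i : K -> B) (u : {rmorphism B -> L}) t : mulseminorm v ->
  approximable w i (v \o u) ->
  approximable w (polyC \o i) (v \o (horner_eval t \o map_poly u)).
Proof.
move=> hv ap.
have [|tr] := pselect (exists p : {poly B}, map_poly u p != 0 /\ root (map_poly u p) t).
  by move=> h; apply: approximable_poly_algebraic.
have {}tr p : root (map_poly u p) t -> map_poly u p = 0.
  by move=> h; apply/eqP; apply: contrapT => /negP h2; apply: tr; exists p.
have dv : dense_values v.
  move=> r l r0 l1; have [a ha] := dw r0 l1; exists (u (i a)).
  have := approximable_base hw a (mulseminorm_comp u hv) ap.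
  by rewrite /= => ->.
move=> l Q l1.
(* Splitting this one product splits every member of [Q] with nonzero image. *)
pose P := \prod_(q <- Q | map_poly u q != 0) q.
have P0 : map_poly u P != 0.
  by rewrite /P rmorph_prod /= prodf_seq_neq0; apply/allP => q _; apply/implyP.
have [E [j [v' [s [hv' v'j sE]]]]] := valued_splitting_field hv dv P0.
pose ju : {rmorphism B -> E} := j \o u.
have ts : j t \notin s.
  apply/negP => h; move/negP: (P0); apply; apply/eqP/tr.
  rewrite -(fmorph_root j) sE rootZ ?root_prod_XsubC //.
  by rewrite fmorph_eq0 lead_coef_eq0 P0.
have [||C [e [u' [ue ap' hs]]]] := @adjoin_family E v' B i ju s.
- move=> C k e u' x xs ue apk; apply: approximable_poly_algebraic => //.
  exists (map_poly e P).
  have -> : map_poly u' (map_poly e P) = map_poly j (map_poly u P).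
    by rewrite -!map_poly_comp; apply: eq_map_poly => b /=; rewrite ue.
  rewrite map_poly_eq0 P0 sE rootZ ?root_prod_XsubC //.
  by rewrite fmorph_eq0 lead_coef_eq0 P0.
- by have -> : v' \o ju = v \o u by apply/funext => b /=; rewrite v'j.
have /boolp.choice[y hy] : forall x, exists c, x \in s -> u' c = x.
  move=> x; have [/hs[c hc]|] := boolP (x \in s); first by exists c.
  by exists 0.
(* One factor [m] for each possible linear factor and one for the leading coefficient. *)
have [m [m1 ml]] := exists_root_lower (size s).+1 l1.
(* A lift of the leading coefficient of the image of [q]; the leading coefficient of [q] itself may
   map to [0]. *)
pose lc (q : {poly B}) := q`_(size (map_poly u q)).-1.
have [phi [ic kphi cl]] := ap' m ([seq e (lc q) | q <- Q] ++ [seq y x - y x' | x <- s, x' <- s]) m1.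
have kphi' c : u' c = 0 -> phi c = 0 by move=> h; apply: kphi; rewrite /= h (msn0 hv').
have [c hc] : exists c, forall x, x \in s -> close m (w (c - phi (y x))) (v' (j t - x)).
  apply: (position_transfer hv' (y := phi \o y)) => // x x' xs x's.
  have := cl (y x - y x'); rewrite /= rmorphB rmorphB /= !hy //; apply.
  by rewrite mem_cat; apply/orP; right; apply: allpairs_f.
exists (horner_eval c \o map_poly (phi \o e)); split.
- by move=> a; rewrite /= /horner_eval map_polyC hornerC /=; exact: ic.
- move=> p /= /eqP; rewrite (msn_eq0 hv) => /tr p0.
  rewrite /horner_eval; suff -> : map_poly (phi \o e) p = 0 by rewrite horner0.
  apply/polyP => k; rewrite coef_map coef0 /=; apply: kphi'.
  by rewrite ue /ju /= -coef_map p0 coef0 rmorph0.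
move=> q qQ; have [q0|q0] := eqVneq (map_poly u q) 0.
  rewrite /= /horner_eval q0 horner0 (msn0 hv).
  have -> : map_poly (phi \o e) q = 0.
    apply/polyP => k; rewrite coef_map coef0 /=; apply: kphi'.
    by rewrite ue /ju /= -coef_map q0 coef0 rmorph0.
  by rewrite horner0 (msn0 hw) /close mulr0.
have [msk mE] : exists msk, map_poly j (map_poly u q) =
    j (u (lc q)) *: \prod_(x <- mask msk s) ('X - x%:P).
  have : map_poly j (map_poly u q) %| \prod_(x <- s) ('X - x%:P).
    have l0 : j (lead_coef (map_poly u P)) != 0 by rewrite fmorph_eq0 lead_coef_eq0.
    rewrite -(dvdpZr _ _ l0) -sE dvdp_map /P rmorph_prod /=.
    by rewrite (big_rem q) //= q0 dvdp_mulr.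
  move=> /dvdp_prod_XsubC[msk /eqpP[[c1 c2] /= /andP[c10 c20] h]]; exists msk.
  have mj : map_poly j (map_poly u q) = (c2 / c1) *: \prod_(x <- mask msk s) ('X - x%:P).
    by rewrite mulrC -scalerA -h scalerA mulVf // scale1r.
  rewrite mj; congr (_ *: _); have := congr1 lead_coef mj.
  rewrite lead_coefZ (monicP (monic_prod_XsubC _ _ _)) mulr1 => <-.
  by rewrite lead_coef_map lead_coefE coef_map.
(* The factorization over [E] lifts to [C] modulo the kernel of [u'], and [phi] kills that
   kernel. *)
have phiE : map_poly (phi \o e) q =
    phi (e (lc q)) *: \prod_(x <- mask msk s) ('X - (phi (y x))%:P).
  pose z := map_poly e q - e (lc q) *: \prod_(x <- mask msk s) ('X - (y x)%:P).
  have mapz (F : comNzRingType) (f : {rmorphism C -> F}) : map_poly f z =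
      map_poly (f \o e) q - f (e (lc q)) *: \prod_(x <- mask msk s) ('X - (f (y x))%:P).
    rewrite rmorphB /= map_polyZ /= rmorph_prod -map_poly_comp; congr (_ - _ *: _).
    by apply: eq_bigr => x _; rewrite rmorphB /= map_polyX map_polyC.
  have z0 : map_poly u' z = 0.
    rewrite mapz; apply/eqP; rewrite subr_eq0; apply/eqP.
    have -> : map_poly (u' \o e) q = map_poly j (map_poly u q).
      by rewrite -map_poly_comp; apply: eq_map_poly => b /=; rewrite ue.
    rewrite mE ue; congr (_ *: _); rewrite big_seq [RHS]big_seq.
    by apply: eq_bigr => x /mem_mask/hy->.
  apply/eqP; rewrite -subr_eq0 -mapz; apply/eqP/polyP => k.
  rewrite coef_map coef0; apply: kphi'.
  by rewrite -[u' _]coef_map z0 coef0.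
have -> : w ((horner_eval c \o map_poly (phi \o e)) q) =
    w (phi (e (lc q))) * \prod_(x <- mask msk s) w (c - phi (y x)).
  rewrite /= /horner_eval phiE hornerZ horner_prod (msnM hw) (msn_prod _ _ hw).
  by congr (_ * _); apply: eq_bigr => x _; rewrite hornerXsubC.
have -> : (v \o (horner_eval t \o map_poly u)) q =
    v' (u' (e (lc q))) * \prod_(x <- mask msk s) v' (j t - x).
  rewrite /= /horner_eval -v'j -horner_map /= mE hornerZ horner_prod (msnM hv') (msn_prod _ _ hv') ue.
  by congr (_ * _); apply: eq_bigr => x _; rewrite hornerXsubC.
have sz : (size (mask msk s) <= size s)%N.
  by apply: size_subseq; apply: mask_subseq.
apply: (@close_weaken _ (m * m ^+ size (mask msk s))).
- apply: le_trans ml; rewrite exprS ler_pM2l; last by lra.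
  by rewrite ler_eXn2l.
- by rewrite mulr_ge0 ?(msn_ge0 hw) ?prodr_ge0 // => *; exact: msn_ge0.
- by rewrite mulr_ge0 ?(msn_ge0 hv') ?prodr_ge0 // => *; exact: msn_ge0.
apply: close_mul; rewrite ?exprn_ge0 ?prodr_ge0 ?(msn_ge0 hw) ?(msn_ge0 hv') //; try lra.
- by move=> *; exact: msn_ge0.
- by move=> *; exact: msn_ge0.
- by apply: cl; rewrite mem_cat; apply/orP; left; apply/mapP; exists q.
apply: close_prod => [|x|x|x xm]; [exact: ltW|exact: msn_ge0|exact: msn_ge0|].
by apply: hc; exact: mem_mask xm.
Qed.

Theorem approximable_tower (L : fieldType) (v : L -> R) (f : {rmorphism K -> L}) (s : seq L) :
  mulseminorm v -> (forall c, v (f c) = w c) ->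
  exists (C : comNzRingType) (e : {rmorphism K -> C}) (u : {rmorphism C -> L}),
    [/\ forall c, u (e c) = f c, approximable w e (v \o u) &
        forall t, t \in s -> exists y, u y = t].
Proof.
move=> hv vf; have [||C [e [u [ue ap hs]]]] := @adjoin_family L v K idfun f s.
- by move=> C k e u t _ _; exact: approximable_poly.
- move=> l Q l1; exists idfun; split => //.
    by move=> b /eqP; rewrite /= vf (msn_eq0 hw) => /eqP.
  by move=> q _; rewrite /= vf; apply: close_refl; [exact: ltW|exact: msn_ge0].
by exists C, e, u.
Qed.

End Tower.

(** * The residue field of a seminorm *)

Section ResidueField.
Variable R : realType.

(** The binomial theorem bounds [N (x + y) ^+ n] by [n.+1%:R * M ^+ n], and exponential growth beats
    the linear factor. *)
Lemma ultrametric_of_triangle (A : comNzRingType) (N : A -> R) :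
  N 0 = 0 -> N 1 = 1 -> (forall x, 0 <= N x) -> {morph N : x y / x * y >-> x * y} ->
  (forall x y, N (x + y) <= N x + N y) -> (forall n, N n%:R <= 1) -> mulseminorm N.
Proof.
move=> N0 N1 Npos NM ND Nn; split => // x y.
set M := Num.max (N x) (N y).
have M0 : 0 <= M by rewrite le_max Npos.
have NX z n : N (z ^+ n) = N z ^+ n.
  by elim: n => [|n IH]; rewrite ?expr0 // !exprS NM IH.
have Nsum n (F : 'I_n -> A) c : (forall k, N (F k) <= c) -> N (\sum_k F k) <= n%:R * c.
  elim: n F => [|n IH] F h; first by rewrite big_ord0 N0 mul0r.
  rewrite big_ord_recl -natr1 mulrDl mul1r [leRHS]addrC; apply: (le_trans (ND _ _)).
  by apply: lerD => //; apply: IH => k; exact: h.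
have pow n : N (x + y) ^+ n <= n.+1%:R * M ^+ n.
  rewrite -NX exprDn; apply: Nsum => k.
  rewrite -mulr_natl NM -[leRHS]mul1r; apply: ler_pM => //.
  have kn : (k <= n)%N by rewrite -ltnS.
  have -> : M ^+ n = M ^+ (n - k) * M ^+ k by rewrite -exprD subnK.
  rewrite NM !NX.
  apply: ler_pM; rewrite ?exprn_ge0 //; apply: lerXn2r;
    by rewrite ?nnegrE // /M le_max lexx ?orbT.
rewrite leNgt; apply/negP => lt.
have [M00|Mn0] := eqVneq M 0.
  by have := pow 1%N; rewrite !expr1 M00 mulr0 leNgt -M00 lt.
have Mp : 0 < M by rewrite lt_def Mn0.
pose q := N (x + y) / M.
have q1 : 1 < q by rewrite ltr_pdivlMr // mul1r.
have qpow n : q ^+ n <= n.+1%:R by rewrite expr_div_n ler_pdivrMr ?exprn_gt0.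
have bern k : 1 + k%:R * (q - 1) <= q ^+ k.
  elim: k => [|k IH]; first by rewrite expr0 mul0r addr0.
  rewrite exprS -natr1.
  have : q * (1 + k%:R * (q - 1)) <= q * q ^+ k by rewrite ler_pM2l //; lra.
  apply: le_trans; have : 0 <= k%:R * (q - 1) * (q - 1) by rewrite !mulr_ge0 //; lra.
  by lra.
have d0 : 0 < (q - 1) ^+ 2 by rewrite exprn_gt0 // subr_gt0.
(* With this [k], squaring Bernoulli's bound gives [q ^+ (k + k)] above [3 * k], hence above the
   permitted [2 * k + 1]. *)
pose k := (Num.bound (3 / (q - 1) ^+ 2)).+1.
have hk : 3 < k%:R * (q - 1) ^+ 2.
  rewrite -ltr_pdivrMr //; apply: lt_le_trans (archi_boundP _) _.
    by rewrite divr_ge0 // ltW.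
  by rewrite ler_nat.
have k1 : 1 <= k%:R :> R by rewrite ler1n.
have := qpow (k + k)%N; rewrite exprD -natr1 natrD.
have b := bern k; have kd : 0 <= k%:R * (q - 1) by rewrite mulr_ge0 //; lra.
have : (k%:R * (q - 1)) * (k%:R * (q - 1)) <= q ^+ k * q ^+ k.
  by apply: ler_pM => //; lra.
have : 3 * k%:R < (k%:R * (q - 1) ^+ 2) * k%:R by rewrite ltr_pM2r //; lra.
rewrite expr2; lra.
Qed.

(** * Extension of an absolute value to the fraction field *)

Section FractionNorm.
Variables (D : idomainType) (v : D -> R).
Hypothesis hv : mulseminorm v.
Hypothesis v0 : forall x, v x = 0 -> x = 0.

Lemma fraction_repr (f : {fraction D}) :
  exists n d, d != 0 /\ f = FracField.tofrac n / FracField.tofrac d.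
Proof.
rewrite -[f]reprK; move: (repr f) => x.
exists (\n_x), (\d_x); split; first exact: denom_ratioP.
unlock FracField.tofrac; rewrite -[X in _ * X]FracField.pi_inv -[RHS]FracField.pi_mul.
rewrite /FracField.mulf /FracField.invf !numden_Ratio ?oner_neq0 ?denom_ratioP //.
by rewrite mul1r mulr1 Ratio_numden.
Qed.

Lemma fraction_norm_exists : exists v' : {fraction D} -> R,
  mulseminorm v' /\ forall x, v' (FracField.tofrac x) = v x.
Proof.
have /boolp.choice[nd hnd] : forall f : {fraction D}, exists nd : D * D,
    nd.2 != 0 /\ f = FracField.tofrac nd.1 / FracField.tofrac nd.2.
  by move=> f; have [n [d h]] := fraction_repr f; exists (n, d).
pose v' f := v (nd f).1 / v (nd f).2.
have vn0 x : x != 0 -> v x != 0 by move=> x0; apply/eqP => /v0 h; rewrite h eqxx in x0.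
have F0 (x : D) : x != 0 -> FracField.tofrac x != 0 by rewrite tofrac_eq0.
have v'E n d : d != 0 -> v' (FracField.tofrac n / FracField.tofrac d) = v n / v d.
  move=> d0; rewrite /v'; have [] := hnd (FracField.tofrac n / FracField.tofrac d).
  case: (nd _) => n' d' /= d0' /eqP; rewrite eqr_div ?F0 //.
  rewrite -!tofracM tofrac_eq => /eqP h.
  by apply/eqP; rewrite eqr_div ?vn0 // -!(msnM hv) h.
have v'F x : v' (FracField.tofrac x) = v x.
  by have := v'E x 1 (oner_neq0 _); rewrite tofrac1 divr1 (msn1 hv) divr1.
exists v'; split => //; split.
- by rewrite -tofrac0 v'F (msn0 hv).
- by rewrite -tofrac1 v'F (msn1 hv).
- by move=> f; rewrite divr_ge0 ?(msn_ge0 hv).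
- move=> f g; have [n [d [d0 ->]]] := fraction_repr f; have [n' [d' [d0' ->]]] := fraction_repr g.
  by rewrite mulf_div -!tofracM !v'E ?mulf_neq0 // !(msnM hv) mulf_div.
- move=> f g; have [n [d [d0 ->]]] := fraction_repr f; have [n' [d' [d0' ->]]] := fraction_repr g.
  rewrite addf_div ?F0 // -!tofracM -tofracD !v'E ?mulf_neq0 // (msnM hv).
  have dp : 0 < v d by rewrite lt_def vn0 ?(msn_ge0 hv).
  have dp' : 0 < v d' by rewrite lt_def vn0 ?(msn_ge0 hv).
  rewrite ler_pdivrMr ?mulr_gt0 // maxr_pMl; last by rewrite mulr_ge0 ?ltW.
  apply: (le_trans (msnD hv _ _)); rewrite !(msnM hv) le_eqVlt; apply/orP; left; apply/eqP.
  by congr (Num.max _ _); field; rewrite gt_eqF.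
Qed.

End FractionNorm.

(** An [idomainType] carries an inverse operation; for the quotient by the support it is obtained by
    classical choice. *)
Definition classical_unit (Q : comNzRingType) : {pred Q} := fun x => `[< exists y, y * x = 1 >].
Definition classical_inv (Q : comNzRingType) (x : Q) : Q :=
  if pselect (exists y, y * x = 1) is left h then sval (cid h) else x.

Lemma classical_mulVr (Q : comNzRingType) : {in @classical_unit Q, left_inverse 1 (@classical_inv Q) *%R}.
Proof.
move=> x /asboolP h; rewrite /classical_inv; case: pselect => // h'.
exact: svalP (cid h').
Qed.

Lemma classical_unitP (Q : comNzRingType) (x y : Q) : y * x = 1 -> x \in @classical_unit Q.
Proof. by move=> h; apply/asboolP; exists y. Qed.

Lemma classical_inv_out (Q : comNzRingType) : {in [predC @classical_unit Q], @classical_inv Q =1 id}.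
Proof.
by move=> x /asboolPn h; rewrite /classical_inv; case: pselect.
Qed.

Definition classical_idomain (Q : comNzRingType)
    (h : forall x y : Q, x * y = 0 -> (x == 0) || (y == 0)) : idomainType :=
  let U : comUnitRingType := HB.pack (Q : Type) (GRing.ComNzRing.class Q)
    (GRing.ComNzRing_hasMulInverse.Build Q (@classical_mulVr Q) (@classical_unitP Q) (@classical_inv_out Q)) in
  HB.pack (Q : Type) (GRing.ComUnitRing.class U) (GRing.ComUnitRing_isIntegral.Build U h).

(** * The quotient by the support of a seminorm *)

Section Support.
Local Open Scope quotient_scope.
Variables (A : comNzRingType) (N : A -> R).
Hypothesis hN : mulseminorm N.

Definition support : {pred A} := fun a => N a == 0.

Lemma support_ideal : idealr_closed support.
Proof.
split; rewrite ?unfold_in /=.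
- by rewrite (msn0 hN).
- by rewrite (msn1 hN) oner_eq0.
- move=> a x y; rewrite !unfold_in => /eqP x0 /eqP y0.
  by rewrite eq_le (msn_ge0 hN) andbT (msnD_le hN) ?(msnM hN) ?x0 ?y0 ?mulr0.
Qed.

Lemma support_prime : prime_idealr_closed support.
Proof. by move=> x y; rewrite !unfold_in (msnM hN) mulf_eq0. Qed.

(** The support is a prime ideal on whose cosets [N] is constant, so [N] descends to a domain and
    then extends to its fraction field. *)
Theorem residue_field_exists : exists (L : fieldType) (pi : {rmorphism A -> L}) (v : L -> R),
  mulseminorm v /\ forall a, v (pi a) = N a.
Proof.
pose I : prime_idealr A := HB.pack support
  (isIdealr.Build A support support_ideal) (isPrimeIdealrClosed.Build A support support_prime).
pose D := classical_idomain (@Quotient.rquot_IdomainAxiom A I).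
pose piD : {rmorphism A -> D} := (\pi_{ideal_quot I} : {rmorphism A -> {ideal_quot I}}).
pose vD (x : D) := N (repr (x : {ideal_quot I})).
have vpi a : vD (piD a) = N a.
  have h : N (repr (\pi_{ideal_quot I} a) - a) = 0.
    by apply/eqP; have : (repr (\pi_{ideal_quot I} a) - a) \in I by rewrite Quotient.idealrBE reprK.
  have half x y : N (x - y) = 0 -> N x <= N y.
    by move=> h'; rewrite -(subrK y x) (msnD_le hN) // h' (msn_ge0 hN).
  by apply/eqP; rewrite eq_le !half // (msnBC hN).
have surj (x : D) : exists a, x = piD a by exists (repr (x : {ideal_quot I})); rewrite /piD /= reprK.
have hvD : mulseminorm vD.
  split.
  - by rewrite -(rmorph0 piD) vpi (msn0 hN).
  - by rewrite -(rmorph1 piD) vpi (msn1 hN).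
  - by move=> x; exact: (msn_ge0 hN).
  - by move=> x y; have [a ->] := surj x; have [b ->] := surj y; rewrite -rmorphM !vpi (msnM hN).
  - by move=> x y; have [a ->] := surj x; have [b ->] := surj y; rewrite -rmorphD !vpi (msnD hN).
have vD0 (x : D) : vD x = 0 -> x = 0.
  have [a ->] := surj x; rewrite vpi => Na; rewrite -(rmorph0 piD).
  by apply/eqP; rewrite -[_ == _]Quotient.idealrBE subr0; apply/eqP.
have [v [hv vF]] := fraction_norm_exists hvD vD0.
exists {fraction D}, (@FracField.tofrac D \o piD), v; split => // a.
by rewrite /= vF vpi.
Qed.

End Support.
End ResidueField.

(** * Tropicalization *)

Lemma exists_third (R : realType) (d : R) : 0 < d -> exists h, 0 < h /\ h + h + h <= d.
Proof. by move=> d0; exists (d / 3); split; lra. Qed.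

Section ExtendedReals.

(* [exp (- z)]; [absv nu a] is convertible to [eexp (nu a)]. *)
Definition eexp (z : ER) : R :=
  match z with None => IZR 0 | Some r => Rtrigo_def.exp (Ropp r) end.

Lemma exp_gt0 (r : R) : 0 < exp r.
Proof. exact/RltP/exp_pos. Qed.

Lemma exp_le_inv (r t : R) : exp r <= exp t -> r <= t.
Proof.
move=> h; rewrite leNgt; apply/negP => /RltP/exp_increasing/RltP.
by rewrite ltNge h.
Qed.

Lemma eexp_ge0 z : 0 <= eexp z.
Proof. by case: z => [r|] //=; rewrite ltW // exp_gt0. Qed.

Lemma eexp_eq0 z : eexp z = 0 -> z = None.
Proof. by case: z => [r|] //= h; have := exp_gt0 (- r); rewrite h ltxx. Qed.

Lemma eexpD y z : eexp (er_add y z) = eexp y * eexp z.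
Proof.
case: y z => [r|] [t|] /=; rewrite ?mul0r ?mulr0 //.
by rewrite Ropp_plus_distr exp_plus.
Qed.

Lemma eexpK z : nlog (eexp z) = z.
Proof.
rewrite /nlog; case: Req_dec_T => [h|] /=; first by rewrite (eexp_eq0 h).
case: z => [r|] //= _.
by rewrite ln_exp Ropp_involutive.
Qed.

Lemma nlogK (r : R) : 0 <= r -> eexp (nlog r) = r.
Proof.
rewrite /nlog; case: Req_dec_T => [h|/eqP r0 rp] /=; first by rewrite h.
by rewrite Ropp_involutive exp_ln //; apply/RltP; rewrite lt_def r0.
Qed.

Lemma eexp_inj : injective eexp.
Proof. by move=> y z h; rewrite -(eexpK y) h eexpK. Qed.

(** At a finite point, closeness up to [exp d] means distance at most [d]. At infinity any [l] will
    do, as closeness there forces equality. *)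
Lemma open_ER_close (V : pset ER) z : open_ER V -> V z ->
  exists l : R, 1 < l /\ forall z', close l (eexp z') (eexp z) -> V z'.
Proof.
move=> oV Vz; case: z Vz (oV z Vz) => [r|] Vz.
  move=> [e [/RltP e0 he]]; have [d [d0 de]] := exists_third e0; exists (exp d); split.
    by rewrite -expR0; exact/RltP/exp_increasing/RltP.
  case=> [t|] /= [h1 h2]; last first.
    by move: h2; rewrite mulr0 leNgt exp_gt0.
  rewrite !expRD in h1 h2; move/exp_le_inv: h1; move/exp_le_inv: h2.
  rewrite !RplusE !RoppE => h1 h2; apply: he; apply/RltP.
  by rewrite RabsE RminusE ltr_norml; apply/andP; split; lra.
move=> _; exists 2; split; first by lra.
by move=> z' [h _]; rewrite mulr0 in h; rewrite (@eexp_eq0 z') //; apply/eqP; rewrite eq_le h eexp_ge0.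
Qed.

Lemma open_ER_eexp (W : pset R) : open_R W -> open_ER (fun z => W (eexp z)).
Proof.
move=> oW [r|] /= Wz; have [e [/RltP e0 he]] := oW _ Wz.
  have [d [/RltP d0 hd]] := derivable_continuous_pt _ _ (derivable_pt_exp (- r)) e (RltP e0).
  exists d; split; first exact/RltP.
  move=> y /RltP hy; apply: he.
  have [->|yr] := eqVneq y r; first by rewrite Rminus_diag Rabs_R0; exact/RltP.
  apply: (hd (- y)); split.
    split => //; move/eqP: yr => + /(congr1 Ropp); rewrite !Ropp_involutive.
    by move=> h /esym.
  apply/RltP; rewrite /= /Rdist RabsE RminusE RoppE -normrN.
  by move: hy; rewrite RabsE RminusE; congr (`|_| < _); ring.
exists (- ln e) => y /RltP ye; apply: he; apply/RltP.
rewrite RabsE RminusE subr0 gtr0_norm ?exp_gt0 // -[ltRHS]exp_ln; last exact/RltP.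
by apply/RltP/exp_increasing/RltP; move: ye; rewrite !RoppE; lra.
Qed.

(** The absolute value keeps the default value of [ln] on negative reals out of play; on values of
    seminorms it changes nothing. *)
Lemma open_R_nlog (V : pset ER) : open_ER V -> open_R (fun r => V (nlog `|r|)).
Proof.
move=> oV r Vr; have [r0|r0] := eqVneq r 0.
  have : V (nlog (IZR 0)) by move: Vr; rewrite r0 normr0.
  rewrite /nlog; case: Req_dec_T => [_|//] /= Vn; have [a ha] := oV _ Vn.
  exists (exp (- a)); split; first exact: exp_pos.
  move=> y /RltP; rewrite r0 RminusE subr0 RabsE => ya; rewrite /nlog.
  case: Req_dec_T => [_|/eqP y0] /=; first exact: Vn.
  apply: ha; apply/RltP; rewrite RoppE ltrNr; apply/RltP/exp_lt_inv/RltP.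
  by rewrite exp_ln //; apply/RltP; rewrite lt_def y0 normr_ge0.
have rp : 0 < `|r| by rewrite normr_gt0.
have [l [l1 hl]] := open_ER_close oV Vr.
have lp : 0 < l by lra.
exists (`|r| * (1 - l^-1)); split.
  by apply/RltP; rewrite mulr_gt0 // subr_gt0 invf_lt1.
move=> y /RltP; rewrite RminusE RabsE => hy; apply: hl; rewrite !nlogK ?normr_ge0 //.
have h1 : `|y| <= `|r| + `|y - r| by rewrite -{1}(subrK r y) addrC ler_normD.
have h2 : `|r| <= `|y| + `|y - r| by rewrite -{1}(subrK y r) addrC distrC ler_normD.
have E : `|r| * (1 - l^-1) = `|r| - `|r| / l by rewrite mulrBr mulr1.
rewrite E in hy.
have D : `|r| = l * (`|r| / l) by rewrite mulrC divfK // gt_eqF.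
have D0 : 0 < `|r| / l by rewrite divr_gt0.
move: (`|r| / l) D D0 hy h1 h2 => c -> c0; split; nra.
Qed.

Lemma open_R_ball (c d : R) : open_R (fun r => `|r - c| < d).
Proof.
move=> r h; exists (d - `|r - c|); split; first by apply/RltP; rewrite subr_gt0.
move=> y /RltP; rewrite RabsE RminusE => hy.
have -> : y - c = (y - r) + (r - c) by ring.
by apply: le_lt_trans (ler_normD _ _) _; rewrite -ltrBrDr.
Qed.

End ExtendedReals.

(** * Generated and initial topologies *)

Section Generated.

Lemma generatedE (T : Type) (S : pset T -> Prop) U : generated S U <-> gen_open S U.
Proof.
split; last by move=> h; exists U.
move=> [V [hV UV]]; suff -> : U = V by [].
by apply/funext => x; apply/propext.
Qed.

Lemma generated_preimage (X T : Type) (f : X -> T) (S : pset X -> Prop) (S' : pset T -> Prop) :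
  (forall U, S' U -> generated S (fun x => U (f x))) ->
  forall U, generated S' U -> generated S (fun x => U (f x)).
Proof.
move=> h U /generatedE; elim=> {U} [U /h//||U V _ IU _ IV|P _ IP].
- exact/generatedE/go_full.
- by apply/generatedE; apply: go_inter; apply/generatedE.
- pose P' (W : pset X) := exists U, P U /\ W = (fun x => U (f x)).
  exists (fun x => exists W, P' W /\ W x); split.
    by apply: go_union => _ [U [PU ->]]; apply/generatedE/IP.
  move=> x; split => [[U [PU Ux]]|[_ [[U [PU ->]] Ux]]]; last by exists U.
  by exists (fun x => U (f x)); split => //; exists U.
Qed.

Lemma initial_continuous (X T I Y : Type) (S : pset X -> Prop) (openY : pset Y -> Prop)
    (g : I -> T -> Y) (f : X -> T) :
  (forall i V, openY V -> generated S (fun x => V (g i (f x)))) ->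
  continuous (generated S) (initial openY g) f.
Proof.
move=> h; apply: generated_preimage => U [i [V [oV UV]]].
suff -> : (fun x => U (f x)) = (fun x => V (g i (f x))) by exact: h.
by apply/funext => x; apply/propext.
Qed.

Lemma initial_basic (T I Y : Type) (openY : pset Y -> Prop) (g : I -> T -> Y) i V :
  openY V -> initial openY g (fun x => V (g i x)).
Proof. by move=> oV; apply/generatedE/go_base; exists i, V. Qed.

Lemma reindex_continuous m n (k : 'I_m -> 'I_n) :
  continuous (@open_ERn n) (@open_ERn m) (fun v i => v (k i)).
Proof.
apply: initial_continuous => i V oV.
exact: (initial_basic (fun (i : 'I_n) (v : 'I_n -> ER) => v i) (k i) oV).
Qed.

Lemma open_ERn_forall m (V : 'I_m -> pset ER) :
  (forall i, open_ER (V i)) -> open_ERn (fun v => forall i, V i (v i)).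
Proof.
move=> oV.
pose S (U : pset ('I_m -> ER)) := exists i V, open_ER V /\ forall v, U v <-> V (v i).
suff h (s : seq 'I_m) : gen_open S (fun v : 'I_m -> ER => forall i, i \in s -> V i (v i)).
  exists (fun v => forall i, i \in enum 'I_m -> V i (v i)); split; first exact: h.
  by move=> v; split => h' i; [by move=> _; exact: h'|by apply: h'; rewrite mem_enum].
elim: s => [|i s IH].
  suff -> : (fun v : 'I_m -> ER => forall i, i \in [::] -> V i (v i)) = (fun=> True) by exact: go_full.
  by apply/funext => v; apply/propext.
suff -> : (fun v : 'I_m -> ER => forall j, j \in i :: s -> V j (v j)) =
    (fun v => V i (v i) /\ forall j, j \in s -> V j (v j)).
  by apply: go_inter => //; apply: go_base; exists i, (V i).
apply/funext => v; apply/propext; split => [h|[h1 h2] j].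
  by split => [|j js]; apply: h; rewrite inE ?eqxx ?js ?orbT.
by rewrite inE => /orP[/eqP->|/h2].
Qed.

Lemma open_ERn_close m (U : pset ('I_m -> ER)) v : open_ERn U -> U v ->
  exists l : R, 1 < l /\
    forall v', (forall i, close l (eexp (v' i)) (eexp (v i))) -> U v'.
Proof.
move=> /generatedE oU; elim: oU v => {U} [U [i [V [oV UV]]]|||].
- move=> v /UV/(open_ER_close oV)[l [l1 h]]; exists l; split => // v' /(_ i)/h.
  by rewrite UV.
- by move=> v _; exists 2; split; [lra|].
- move=> U V _ IU _ IV v [/IU[l [l1 hl]] /IV[m' [m1 hm]]].
  exists (Num.min l m'); split; first by rewrite lt_min l1.
  move=> v' h; split; [apply: hl|apply: hm] => i;
    by apply: (close_weaken _ _ _ (h i)); rewrite ?eexp_ge0 // ge_min lexx ?orbT.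
- move=> P _ IP v [U [PU Uv]]; have [l [l1 h]] := IP U PU v Uv.
  by exists l; split => // v' /h Uv'; exists U.
Qed.

End Generated.

Section Polynomials.
Variable K : Type.

Lemma peval_morph (P Q : pzRingType) (f : {rmorphism P -> Q}) m (s : K -> P) (v : 'I_m -> P) p :
  f (peval s v p) = peval (f \o s) (f \o v) p.
Proof. by elim: p => //= [p IHp q IHq|p IHp q IHq]; rewrite ?rmorphD ?rmorphM IHp IHq. Qed.

Fixpoint pexpr_map m n (r : 'I_m -> 'I_n) (p : pexpr K m) : pexpr K n :=
  match p with
  | PC c => PC n c
  | PX i => PX K (r i)
  | PAdd p q => PAdd (pexpr_map r p) (pexpr_map r q)
  | PMul p q => PMul (pexpr_map r p) (pexpr_map r q)
  end.

Lemma peval_map (P : pzRingType) m n (r : 'I_m -> 'I_n) (s : K -> P) v p :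
  peval s v (pexpr_map r p) = peval s (v \o r) p.
Proof. by elim: p => //= [p -> q ->|p -> q ->]. Qed.

End Polynomials.

Section Tropicalization.
Variables (K : closedFieldType) (nu : K -> ER) (A : comAlgType K).
Hypothesis Hnu : nonarch_valuation nu.

Lemma absv_mulseminorm : mulseminorm (absv nu).
Proof.
have [n0 nn0 nM nD] := Hnu.
have n1 : nu 1 = Some (IZR 0).
  have := nM 1 1; rewrite mulr1; case E: (nu 1) => [r|] /=; last first.
    by have := nn0 1 (elimN eqP (oner_neq0 K)); rewrite E.
  by case; rewrite RplusE => h; congr Some; have : r = 0 :> R by lra.
split.
- by rewrite /absv n0.
- by rewrite /absv n1 Ropp_0 exp_0.
- by move=> a; exact: eexp_ge0.
- by move=> a b; rewrite -eexpD -nM.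
- move=> a b; have := nD a b; rewrite /absv.
  case: (nu a) (nu b) (nu (a + b)) => [r|] [t|] [q|] //=; rewrite ?le_max ?lexx ?orbT //.
  + rewrite RminE => /RleP; rewrite ge_min => /orP[] h; apply/orP; [left|right];
      rewrite leNgt; apply/negP => /RltP/exp_lt_inv/RltP; rewrite !RoppE; lra.
  + by rewrite ltW ?exp_gt0.
  + move=> /RleP h; apply/orP; left.
    by rewrite leNgt; apply/negP => /RltP/exp_lt_inv/RltP; rewrite !RoppE; lra.
  + move=> /RleP h; apply/orP; right.
    by rewrite leNgt; apply/negP => /RltP/exp_lt_inv/RltP; rewrite !RoppE; lra.
Qed.

(** Compatibility with [nu] bounds the integers by [1], which upgrades the triangle inequality to
    the ultrametric one. *)
Lemma Xan_mulseminorm (x : Xan nu A) : mulseminorm (proj1_sig x).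
Proof.
case: x => s [s_ge0 [s0 s1 sM sD sc]] /=.
apply: ultrametric_of_triangle => //.
- by move=> a; exact/RleP.
- by move=> a b; apply/RleP; exact: sD.
- move=> n; have -> : n%:R = (n%:R : K)%:A :> A by rewrite scaler_nat.
  by rewrite sc; exact: (msn_nat absv_mulseminorm).
Qed.

Lemma kpoint_peval (x : A -> K) m (g : 'I_m -> A) p : is_Kpoint x ->
  x (peval (fun c => c%:A) g p) = peval (fun c => c) (fun i => x (g i)) p.
Proof.
move=> [x1 xD xM xc]; elim: p => //= [p IHp q IHq|p IHp q IHq].
  by rewrite xD IHp IHq.
by rewrite xM IHp IHq.
Qed.

(** The generators are lifted to a ring [C] above [K], approximable inside the residue field of [x];
    a point [phi] of [C] then induces one of [A]. *)
Lemma kpoint_approximation (Hnt : nontrivial_valuation nu) (x : Xan nu A) (e : Emb A) (l : R) :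
  1 < l -> exists p : A -> K, is_Kpoint p /\
    forall i, close l (absv nu (p (egen e i))) (proj1_sig x (egen e i)).
Proof.
move=> l1; have hw := absv_mulseminorm; have hx := Xan_mulseminorm x.
have dw : dense_values (absv nu).
  apply: dense_values_closed => //; have [a [a0 na]] := Hnt.
  exists a; split; first exact/eqP.
  have [_ /(_ a a0) + _ _] := Hnu; rewrite /absv.
  case: (nu a) na => // r r0 _; apply/eqP => /(congr1 ln).
  rewrite ln_exp ln_1 => /(congr1 Ropp); rewrite Ropp_involutive Ropp_0 => h.
  by apply: r0; rewrite h.
have [L [pi [v [hv vpi]]]] := residue_field_exists hx.
pose f : {rmorphism K -> L} := pi \o in_alg A.
have vf c : v (f c) = absv nu c.
  by rewrite /f /= vpi; case: (x) => s [_ []] /=.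
have [C [k [u [uk ap hs]]]] :=
  approximable_tower hw dw [seq pi (egen e i) | i <- enum 'I_(edim e)] hv vf.
have /boolp.choice[y hy] : forall i, exists c, u c = pi (egen e i).
  by move=> i; apply: hs; apply/mapP; exists i; rewrite ?mem_enum.
have [phi [ik kphi cl]] := ap l [seq y i | i <- enum 'I_(edim e)] l1.
have /boolp.choice[P hP] := proj2_sig (projT2 e).
(* An arbitrary lift of [pi a] to [C]. It respects the operations only modulo the kernel of [u],
   which suffices because [phi] kills that kernel. *)
pose ev a := peval k y (P a).
have uev a : u (ev a) = pi a.
  rewrite /ev peval_morph {2}(hP a) (peval_morph pi); congr peval.
    by apply/funext => c /=; rewrite uk.
  by apply/funext => i /=; rewrite hy.
have key a c : u c = pi a -> phi (ev a) = phi c.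
  move=> h; apply/eqP; rewrite -subr_eq0 -rmorphB; apply/eqP/kphi.
  by rewrite /= rmorphB uev h subrr (msn0 hv).
exists (phi \o ev); split; first split.
- by rewrite /= (key _ 1) ?rmorph1.
- by move=> a b /=; rewrite -rmorphD; apply: key; rewrite !rmorphD !uev.
- by move=> a b /=; rewrite -rmorphM; apply: key; rewrite !rmorphM !uev.
- by move=> c /=; rewrite (key _ (k c)) ?ik // uk.
move=> i /=; rewrite (key _ (y i)) ?hy //.
have := cl (y i); rewrite /= hy vpi; apply.
by apply/mapP; exists i; rewrite ?mem_enum.
Qed.

Lemma pi_emb_in_trop (Hnt : nontrivial_valuation nu) (x : Xan nu A) (e : Emb A) :
  Trop_emb nu e (pi_emb e x).
Proof.
move=> U oU /(open_ERn_close oU)[l [l1 h]].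
have [p [hp cl]] := kpoint_approximation Hnt x e l1.
exists (fun i => nu (p (egen e i))); split; first by exists p.
by apply: h => i; rewrite /pi_emb nlogK; [exact: cl|exact: (msn_ge0 (Xan_mulseminorm x))].
Qed.

(** * Closed conditions on tropicalizations *)

Lemma trop_approximation (e : Emb A) v (d : R) : Trop_emb nu e v -> 0 < d ->
  exists x, is_Kpoint x /\ forall i, `|absv nu (x (egen e i)) - eexp (v i)| < d.
Proof.
move=> tv d0.
have [||v' [[x [hx xE]] h]] := tv (fun v' => forall i, `|eexp (v' i) - eexp (v i)| < d).
- apply: (open_ERn_forall (V := fun i z => `|eexp z - eexp (v i)| < d)) => i.
  exact: (open_ER_eexp (@open_R_ball (eexp (v i)) d)).
- by move=> i; rewrite subrr normr0.
by exists x; split => // i; have := h i; rewrite xE.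
Qed.

Lemma small_eq (a b : R) : (forall d, 0 < d -> `|a - b| < d) -> a = b.
Proof.
move=> h; apply/eqP; rewrite -subr_eq0 -normr_eq0 eq_le normr_ge0 andbT.
by rewrite leNgt; apply/negP => /h; rewrite ltxx.
Qed.

Lemma trop_coord_eq (e : Emb A) v i j : Trop_emb nu e v ->
  egen e i = egen e j -> v i = v j.
Proof.
move=> tv ij; apply: eexp_inj; apply: small_eq => d d0.
have [t [t0 td]] := exists_third d0.
have [x [hx h]] := trop_approximation tv t0.
have := h i; have := h j; rewrite ij !ltr_norml => /andP[? ?] /andP[? ?].
by apply/andP; split; lra.
Qed.

Lemma trop_coord_const (e : Emb A) v i c : Trop_emb nu e v ->
  egen e i = c%:A -> eexp (v i) = absv nu c.
Proof.
move=> tv ic; apply: small_eq => d d0.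
have [x [[_ _ _ xc] h]] := trop_approximation tv d0.
by have := h i; rewrite ic xc distrC.
Qed.

Lemma trop_coord_mul (e : Emb A) v i j k : Trop_emb nu e v ->
  egen e k = egen e i * egen e j -> eexp (v k) = eexp (v i) * eexp (v j).
Proof.
move=> tv kE; have hw := absv_mulseminorm.
apply: small_eq => d d0; set a := eexp (v i); set b := eexp (v j).
have a0 : 0 <= a := eexp_ge0 _; have b0 : 0 <= b := eexp_ge0 _.
(* The identity [E] below bounds the error by [t * (a + b + 2)]; [t <= 1] controls the product of
   the two coordinate errors. *)
pose t := Num.min 1 (d / (a + b + 3)).
have t0 : 0 < t by rewrite lt_min ltr01 divr_gt0 //; lra.
have t1 : t <= 1 by rewrite ge_min lexx.
have td : t * (a + b + 3) <= d.
  by rewrite -ler_pdivlMr ?ge_min ?lexx ?orbT //; lra.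
have [x [[_ _ xM _] h]] := trop_approximation tv t0.
have := h i; have := h j; have := h k; rewrite kE xM (msnM hw) -/a -/b.
set p := absv nu (x (egen e i)); set q := absv nu (x (egen e j)).
move: (eexp (v k)) => r hr hq hp.
have : `|(p - a) * (q - b)| < t * 1.
  by rewrite normrM; apply: ltr_pM => //; exact: lt_le_trans hq t1.
move: hr hq hp; rewrite mulr1 !ltr_norml => /andP[? ?] /andP[? ?] /andP[? ?] /andP[B1 B2].
have E : r - a * b = (r - p * q) + (p - a) * (q - b) + a * (q - b) + b * (p - a) by ring.
have B3 : a * (q - b) <= a * t by rewrite ler_wpM2l //; lra.
have B4 : - (a * t) <= a * (q - b) by rewrite -mulrN ler_wpM2l //; lra.
have B5 : b * (p - a) <= b * t by rewrite ler_wpM2l //; lra.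
have B6 : - (b * t) <= b * (p - a) by rewrite -mulrN ler_wpM2l //; lra.
by rewrite E; apply/andP; split; lra.
Qed.

Lemma trop_coord_add (e : Emb A) v i j k : Trop_emb nu e v ->
  egen e k = egen e i + egen e j -> eexp (v k) <= eexp (v i) + eexp (v j).
Proof.
move=> tv kE; have hw := absv_mulseminorm.
apply/ler_addgt0Pl => d d0.
have [t [t0 td]] := exists_third d0.
have [x [[_ xD _ _] h]] := trop_approximation tv t0.
have := msnD hw (x (egen e i)) (x (egen e j)); rewrite -xD -kE.
have := h i; have := h j; have := h k.
have := msn_ge0 hw (x (egen e i)); have := msn_ge0 hw (x (egen e j)).
rewrite !ltr_norml => ? ? /andP[? ?] /andP[? ?] /andP[? ?].
by rewrite le_max => /orP[] ?; lra.
Qed.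

(* [e] contains the coordinates of both [e1] and [e2], so that the relation between them is a
   closed condition on the points of the tropicalization of [e], satisfied by the [K]-points. *)
Lemma trop_relation (e e1 e2 : Emb A) v (k1 : 'I_(edim e1) -> 'I_(edim e))
    (k2 : 'I_(edim e2) -> 'I_(edim e)) (phi : 'I_(edim e2) -> pexpr K (edim e1)) F :
  Trop_emb nu e v ->
  (forall i, egen e (k1 i) = egen e1 i) -> (forall j, egen e (k2 j) = egen e2 j) ->
  (forall j, egen e2 j = peval (fun c => c%:A) (egen e1) (phi j)) ->
  continuous (@open_ERn (edim e1)) (@open_ERn (edim e2)) F ->
  (forall (y : 'I_(edim e1) -> K) j,
     nu (peval (fun c : K => c) y (phi j)) = F (fun i => nu (y i)) j) ->
  forall j, v (k2 j) = F (fun i => v (k1 i)) j.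
Proof.
move=> tv E1 E2 rel cF hF j; apply: contrapT => ne.
set z := v (k2 j) in ne; set z' := F _ j in ne.
have [|d [d0 hd]] := @exists_third _ `|eexp z - eexp z'|.
  by rewrite normr_gt0 subr_eq0; apply/eqP => /eexp_inj.
pose W c : pset ER := fun t => `|eexp t - eexp c| < d.
have oW c : open_ER (W c) by exact: (open_ER_eexp (@open_R_ball (eexp c) d)).
have o1 : open_ERn (fun v' : 'I_(edim e) -> ER => W z (v' (k2 j))).
  exact: (initial_basic (fun (i : 'I_(edim e)) (v : 'I_(edim e) -> ER) => v i) _ (oW z)).
have o2 : open_ERn (fun v' : 'I_(edim e) -> ER => W z' (F (fun i => v' (k1 i)) j)).
  apply: (reindex_continuous k1 (V := fun v' => W z' (F v' j))).
  apply: (cF (fun v' => W z' (v' j))).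
  exact: (initial_basic (fun (i : 'I_(edim e2)) (v : 'I_(edim e2) -> ER) => v i) _ (oW z')).
have o : open_ERn (fun v' : 'I_(edim e) -> ER =>
    W z (v' (k2 j)) /\ W z' (F (fun i => v' (k1 i)) j)).
  by apply/generatedE; apply: go_inter; apply/generatedE.
have [|v' [[x [hx xE]] [h1 h2]]] := tv _ o.
  by split; rewrite /W subrr normr0.
have Ev : v' (k2 j) = F (fun i => v' (k1 i)) j.
  rewrite xE E2 rel kpoint_peval // hF; congr (F _ j).
  by apply/funext => i; rewrite xE E1.
move: h1 h2; rewrite /W Ev; move: (eexp (F _ _)) => t h1 h2.
have : `|eexp z - eexp z'| <= `|eexp z - t| + `|t - eexp z'|.
  by apply: le_trans (ler_normD _ _); rewrite addrA subrK.
by rewrite (distrC (eexp z) t); lra.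
Qed.

(** * Enlarged embeddings and points of the inverse limit *)

Lemma generates_cat m k (f : 'I_m -> A) (g : 'I_k -> A) : generates f ->
  generates (fun i : 'I_(m + k) => match split i with inl a => f a | inr b => g b end).
Proof.
move=> gf a; have [p ->] := gf a; exists (pexpr_map (lshift k) p).
rewrite peval_map; congr peval; apply/funext => i /=.
by rewrite (unsplitK (inl i)).
Qed.

(** This makes any finite list of functions appear among the coordinates of one embedding. *)
Definition emb_cat (e : Emb A) k (g : 'I_k -> A) : Emb A :=
  existT _ (edim e + k)%N (exist _ _ (generates_cat g (proj2_sig (projT2 e)))).

Lemma egen_lshift e k (g : 'I_k -> A) i : egen (emb_cat e g) (lshift k i) = egen e i.
Proof. by rewrite /egen /= (unsplitK (inl i)). Qed.

Lemma egen_rshift e k (g : 'I_k -> A) i : egen (emb_cat e g) (rshift (edim e) i) = g i.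
Proof. by rewrite /egen /= (unsplitK (inr i)). Qed.

Lemma lim_pi_in_lim (Hnt : nontrivial_valuation nu) (x : Xan nu A) : in_lim nu (lim_pi x).
Proof.
split=> [e|e1 e2 phi _ rel F cF hF j]; first exact: pi_emb_in_trop.
have := trop_relation (e := emb_cat e1 (egen e2)) (@pi_emb_in_trop Hnt x (emb_cat e1 (egen e2)))
  (@egen_lshift e1 _ (egen e2)) (@egen_rshift e1 _ (egen e2)) rel cF hF j.
rewrite /pi_emb egen_rshift /lim_pi /pi_emb => ->; congr (F _ j).
by apply/funext => i; rewrite egen_lshift.
Qed.

Section Limit.
Variable p : Fam A.
Arguments p : clear implicits.
Hypothesis hp : in_lim nu p.

(** A selection of coordinates is equivariant for the same selection on tori, and its
    tropicalization is reindexing. *)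
Lemma lim_projection (e1 e : Emb A) (k : 'I_(edim e1) -> 'I_(edim e)) :
  (forall i, egen e1 i = egen e (k i)) -> forall i, p e1 i = p e (k i).
Proof.
move=> E i; have [_ comp] := hp.
apply: (comp e e1 (fun i => PX K (k i)) _ E (fun v i => v (k i))) => //.
  exists (fun t i => t (k i)); split => // t ht j; exact: ht.
exact: reindex_continuous.
Qed.

(** Both coordinates are read in the joint embedding, where they belong to the same function. Hence
    a point of the limit assigns a value to each function, independently of the embedding. *)
Lemma lim_coord_eq (e1 e2 : Emb A) i j : egen e1 i = egen e2 j -> p e1 i = p e2 j.
Proof.
move=> ij; pose e := emb_cat e1 (egen e2).
rewrite (lim_projection (e := e) (k := fun i => lshift (edim e2) i)); last by move=> ?; rewrite egen_lshift.
rewrite (lim_projection (e := e) (k := fun i => rshift (edim e1) i)); last by move=> ?; rewrite egen_rshift.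
by apply: (trop_coord_eq (hp.1 e)); rewrite egen_lshift egen_rshift.
Qed.

Variable e0 : Emb A.

(** The embedding [e0] only provides generators to which [a] is appended; by [lim_coord_eq] the
    value does not depend on it. *)
Definition lim_seminorm (a : A) : R :=
  eexp (p (emb_cat e0 (fun _ : 'I_1 => a)) (rshift (edim e0) ord0)).

Lemma lim_seminormE e i : lim_seminorm (egen e i) = eexp (p e i).
Proof. by congr eexp; apply: lim_coord_eq; rewrite egen_rshift. Qed.

Lemma lim_seminorm_triple (a b c : A) : exists (e : Emb A) (i j k : 'I_(edim e)),
  [/\ egen e i = a, egen e j = b & egen e k = c].
Proof.
pose g (i : 'I_3) := nth 0 [:: a; b; c] i.
exists (emb_cat e0 g), (rshift _ (inord 0)), (rshift _ (inord 1)), (rshift _ (inord 2)).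
by rewrite !egen_rshift /g !inordK.
Qed.

Lemma lim_seminorm_is_seminorm : is_seminorm nu lim_seminorm.
Proof.
have const c : lim_seminorm c%:A = absv nu c.
  by apply: (trop_coord_const (hp.1 _)); rewrite egen_rshift.
have hw := absv_mulseminorm.
split; first by move=> a; apply/RleP; exact: eexp_ge0.
split => //.
- by rewrite -(scale0r 1) const (msn0 hw).
- by rewrite -(scale1r 1) const (msn1 hw).
- move=> a b; have [e [i [j [k [ia jb kc]]]]] := lim_seminorm_triple a b (a * b).
  rewrite -kc -ia -jb !lim_seminormE; apply: (trop_coord_mul (hp.1 e)).
  by rewrite kc ia jb.
- move=> a b; have [e [i [j [k [ia jb kc]]]]] := lim_seminorm_triple a b (a + b).
  apply/RleP; rewrite -kc -ia -jb !lim_seminormE; apply: (trop_coord_add (hp.1 e)).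
  by rewrite kc ia jb.
Qed.

Lemma lim_pi_surjective : exists x : Xan nu A, lim_pi x = p.
Proof.
exists (exist _ lim_seminorm lim_seminorm_is_seminorm).
apply: functional_extensionality_dep => e; apply/funext => i.
by rewrite /lim_pi /pi_emb /= lim_seminormE eexpK.
Qed.

End Limit.

(** * Injectivity and comparison of topologies *)

Lemma lim_pi_eexp (x : Xan nu A) e i : eexp (lim_pi x e i) = proj1_sig x (egen e i).
Proof. by rewrite /lim_pi /pi_emb nlogK //; exact: (msn_ge0 (Xan_mulseminorm x)). Qed.

Lemma lim_pi_injective (e0 : Emb A) (x y : Xan nu A) : lim_pi x = lim_pi y -> x = y.
Proof.
move=> h; have E : proj1_sig x = proj1_sig y.
  apply/funext => a.
  by rewrite -(egen_rshift e0 (fun _ : 'I_1 => a) ord0) -!lim_pi_eexp h.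
by case: x y {h} E => s hs [t ht] /= E; exact: eq_exist.
Qed.

Lemma lim_pi_continuous : continuous (open_Xan nu A) (open_Fam A) lim_pi.
Proof.
apply: initial_continuous => -[e i] V /open_R_nlog oV.
have := initial_basic (fun (f : A) (x : Xan nu A) => proj1_sig x f) (egen e i) oV.
congr generated; apply/funext => x /=.
by rewrite ger0_norm //; exact: (msn_ge0 (Xan_mulseminorm x)).
Qed.

(** A subbasic set is a condition on one function, which is a coordinate of some embedding;
    intersections and unions are then followed through the generation. *)
Lemma lim_pi_open (e0 : Emb A) U : open_Xan nu A U ->
  exists V, open_Fam A V /\ forall x, U x <-> V (lim_pi x).
Proof.
move=> /generatedE; elim=> {U} [U [a [W [oW UW]]]||U V _ [U' [oU hU]] _ [V' [oV hV]]|P _ IP].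
- pose e := emb_cat e0 (fun _ : 'I_1 => a).
  exists (fun q : Fam A => W (eexp (q e (rshift (edim e0) ord0)))); split.
    exact: (initial_basic (fun (k : {e : Emb A & 'I_(edim e)}) (p : Fam A) => p (projT1 k) (projT2 k))
      (existT (fun e => 'I_(edim e)) e (rshift (edim e0) ord0)) (open_ER_eexp oW)).
  by move=> x; rewrite lim_pi_eexp egen_rshift.
- by exists (fun=> True); split => //; apply/generatedE/go_full.
- exists (fun q => U' q /\ V' q); split; last by move=> x; rewrite hU hV.
  by apply/generatedE; apply: go_inter; apply/generatedE.
- pose P' (V : pset (Fam A)) := open_Fam A V /\ exists U, P U /\ forall x, U x <-> V (lim_pi x).
  exists (fun q => exists V, P' V /\ V q); split.
    by apply/generatedE; apply: go_union => V [/generatedE].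
  move=> x; split => [[U [PU Ux]]|[V [[_ [U [PU UV]]] Vx]]].
    have [V [oV UV]] := IP U PU; exists V; split; last exact/UV.
    by split => //; exists U.
  by exists U; split => //; exact/UV.
Qed.

End Tropicalization.

Theorem theorem1 (K : closedFieldType) (nu : K -> option R) (A : comAlgType K)
  (Hnu : nonarch_valuation nu) (Hnt : nontrivial_valuation nu)
  (Hcomplete : complete_valuation nu)
  (HA : affine_coordinate_ring A) :
  (* lim pi_iota maps X^an into lim Trop(X, iota) ... *)
  (forall x : Xan nu A, in_lim nu (lim_pi x)) /\
  (* ... injectively ... *)
  (forall x y : Xan nu A, lim_pi x = lim_pi y -> x = y) /\
  (* ... onto lim Trop(X, iota) ... *)
  (forall p : Fam A, in_lim nu p -> exists x : Xan nu A, lim_pi x = p) /\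
  (* ... continuously ... *)
  continuous (open_Xan nu A) (open_Fam A) (lim_pi) /\
  (* ... and open onto its image (subspace topology of the limit) *)
  (forall U, open_Xan nu A U ->
     exists V, open_Fam A V /\ forall x, U x <-> V (lim_pi x)).
Proof.
(* Finite generation supplies a first embedding, to which further functions are appended. *)
have [[m [f gf]] _ _] := HA; pose e0 : Emb A := existT _ m (exist _ f gf).
split; first by move=> x; exact: lim_pi_in_lim.
split; first exact: lim_pi_injective.
split; first by move=> p hp; exact: lim_pi_surjective.
split; first exact: lim_pi_continuous.
exact: lim_pi_open.
Qed.
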